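(* Let $\alpha>N$ be a real number and let $\Omega\subset\mathbb R^N$ be a bounded $C^1$ domain with $\operatorname{diam}\Omega<e^{\frac{1}{N-\alpha}}$. Define $$u(x)=\int_\Omega |x-y|^{\alpha-N}\log\frac{1}{|x-y|}\,dy,\qquad x\in\mathbb R^N.$$ If $u$ is constant on $\partial\Omega$, then $\Omega$ is a ball.
   Context: A domain is a nonempty connected open set; $\operatorname{diam}\Omega=\sup_{x,y\in\Omega}|x-y|$. The integrand is understood to be $0$ at $y=x$. *)

(* Defs.v *)
From HB Require Import structures.
From mathcomp Require Import all_boot all_order all_algebra.
From mathcomp Require Import all_classical all_reals all_analysis.

Set Implicit Arguments.
Unset Strict Implicit.
Unset Printing Implicit Defensive.

Import Order.TTheory GRing.Theory Num.Theory.
Import numFieldNormedType.Exports.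

Local Open Scope classical_set_scope.
Local Open Scope ring_scope.

(* The library gives 'rV[R]_N the sup norm: its topology and its bounded sets
   are the usual ones, but its balls and distances are not Euclidean. *)
Definition enorm (R : realType) (N : nat) (x : 'rV[R]_N) : R :=
  Num.sqrt (\sum_(i < N) x ord0 i ^+ 2).

Definition eball (R : realType) (N : nat) (c : 'rV[R]_N) (r : R)
    : set 'rV[R]_N :=
  [set x | enorm (x - c) < r].

Definition diam (R : realType) (N : nat) (A : set 'rV[R]_N) : R :=
  sup [set enorm (p.1 - p.2) | p in A `*` A].

Definition boundary (T : topologicalType) (A : set T) : set T :=
  closure A `\` interior A.

Definition domain (T : topologicalType) (A : set T) : Prop :=
  [/\ A !=set0, open A & connected A].

Definition C1_fun (R : realType) (m : nat) (g : 'rV[R]_m -> R) : Prop :=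
  (forall x, differentiable g x) /\
  (forall v : 'rV[R]_m, continuous (fun x => 'D_v g x)).

(* Near every boundary point the set is, up to relabelling and reorienting the
   coordinate axes, the strict epigraph of a C^1 function of N - 1 variables:
   k is the axis of the graph, b its orientation, and [col' k x] the vector of
   the N - 1 other coordinates of x. *)
Definition C1_boundary (R : realType) (N : nat) (A : set 'rV[R]_N) : Prop :=
  forall p, boundary A p ->
    exists (r : R) (k : 'I_N) (b : bool) (g : 'rV[R]_N.-1 -> R),
      [/\ 0 < r, C1_fun g &
        A `&` eball p r =
        [set x | g (col' k x) < (-1) ^+ b * x ord0 k] `&` eball p r].

(* The Borel sigma-algebra of 'rV[R]_N, generated by the coordinates. *)
Section measurable_rV.
Variables (R : realType) (N : nat).

Let coord (i : 'I_N) (x : 'rV[R]_N) : R := x ord0 i.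

Let rV_set0 : g_sigma_preimage coord set0.
Proof. exact: sigma_algebra0. Qed.

Let rV_setC A : g_sigma_preimage coord A -> g_sigma_preimage coord (~` A).
Proof. exact: sigma_algebraC. Qed.

Let rV_bigcup (F : (set 'rV[R]_N)^nat) :
  (forall i, g_sigma_preimage coord (F i)) ->
  g_sigma_preimage coord (\bigcup_i (F i)).
Proof. exact: sigma_algebra_bigcup. Qed.

HB.instance Definition _ := @isMeasurable.Build
  (measure_tuple_display default_measure_display)
  'rV[R]_N (g_sigma_preimage coord) rV_set0 rV_setC rV_bigcup.

Lemma measurable_coord_rV (i : 'I_N) :
  measurable_fun [set: 'rV[R]_N] (fun x => x ord0 i).
Proof.
move=> _ Y mY; rewrite setTI; apply: sub_sigma_algebra => /=.
rewrite -bigcup_seq/=; exists i => /=; first by rewrite mem_index_enum.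
by exists Y => //; rewrite setTI.
Qed.

Lemma measurable_fun_rV d (T : measurableType d) (f : T -> 'rV[R]_N) :
  (forall i, measurable_fun [set: T] (fun t => f t ord0 i)) ->
  measurable_fun [set: T] f.
Proof.
move=> mf _ A mA; rewrite setTI; move: A mA; apply: smallest_sub.
  split=> [|A mA|F mF] /=.
  - by rewrite preimage_set0.
  - by rewrite setTD preimage_setC; exact: measurableC.
  - by rewrite preimage_bigcup; exact: bigcupT_measurable.
rewrite -bigcup_seq/=; apply: bigcup_sub => i _ A [B mB <-] /=.
by have := mf i measurableT _ mB; rewrite !setTI.
Qed.

End measurable_rV.

(* Lebesgue measure on 'rV[R]_N, by recursion on N: the product of the Lebesgue
   measure on the first coordinate and of the one on the N - 1 others. *)
Section lebesgue_rV.
Variable R : realType.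

Definition cons_rV (N : nat) (p : measurableTypeR R * 'rV[R]_N) : 'rV[R]_N.+1 :=
  \row_i oapp (fun j => p.2 ord0 j) p.1 (unlift ord0 i).

Lemma measurable_cons_rV N : measurable_fun setT (@cons_rV N).
Proof.
apply: measurable_fun_rV => i.
under eq_fun do rewrite mxE.
case: (unliftP ord0 i) => [j|] _ /=; last exact: measurable_fst.
exact: (measurableT_comp (measurable_coord_rV j) measurable_snd).
Qed.

Lemma cons_rVK N (x : 'rV[R]_N.+1) :
  cons_rV (x ord0 ord0, \row_j x ord0 (lift ord0 j)) = x.
Proof.
apply/rowP => i; rewrite mxE.
by case: unliftP => [j|] -> //=; rewrite mxE.
Qed.

Section step.
Variables (N : nat) (mu : {sigma_finite_measure set 'rV[R]_N -> \bar R}).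

Definition lebesgue_rV_step : set 'rV[R]_N.+1 -> \bar R :=
  pushforward (@lebesgue_measure R \x mu)%E (@cons_rV N).

Let mcons := @measurable_cons_rV N.

Let step0 : lebesgue_rV_step set0 = 0%E.
Proof. by rewrite /lebesgue_rV_step; have mf := mcons; exact: measure0. Qed.

Let step_ge0 A : (0 <= lebesgue_rV_step A)%E.
Proof. by rewrite /lebesgue_rV_step; have mf := mcons; exact: measure_ge0. Qed.

Let step_sigma_additive : semi_sigma_additive lebesgue_rV_step.
Proof.
by rewrite /lebesgue_rV_step; have mf := mcons; exact: measure_semi_sigma_additive.
Qed.

HB.instance Definition _ := isMeasure.Build _ _ _ lebesgue_rV_step
  step0 step_ge0 step_sigma_additive.

Let step_sigma_finite : sigma_finite setT lebesgue_rV_step.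
Proof.
have /sigma_finiteP[F [FT ndF Foo]] := sigma_finiteT (@lebesgue_measure R).
have /sigma_finiteP[G [GT ndG Goo]] := sigma_finiteT mu.
pose tail_rV (x : 'rV[R]_N.+1) : 'rV[R]_N := \row_j x ord0 (lift ord0 j).
have mhead : measurable_fun setT (fun x : 'rV[R]_N.+1 => x ord0 ord0).
  exact: measurable_coord_rV.
have mtail : measurable_fun setT tail_rV.
  apply: measurable_fun_rV => j; under eq_fun do rewrite mxE.
  exact: measurable_coord_rV.
exists (fun n => [set x : 'rV[R]_N.+1 | F n (x ord0 ord0) /\ G n (tail_rV x)]).
  apply/esym; rewrite -subTset => x _.
  have : [set: measurableTypeR R] (x ord0 ord0) by [].
  have : [set: 'rV[R]_N] (tail_rV x) by [].
  rewrite GT FT => -[n _ Gn] [m _ Fm]; exists (maxn m n) => //; split.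
  - by have /subsetPset := ndF _ _ (leq_maxl m n); exact.
  - by have /subsetPset := ndG _ _ (leq_maxr m n); exact.
move=> n; have [mF Fn_oo] := Foo n; have [mG Gn_oo] := Goo n; split.
  apply: measurableI.
    by have := mhead measurableT _ mF; rewrite setTI.
  by have := mtail measurableT _ mG; rewrite setTI.
rewrite /lebesgue_rV_step /pushforward.
rewrite (_ : _ @^-1` _ = F n `*` G n).
  by rewrite product_measure1E// lte_mul_pinfty// ge0_fin_numE.
have tailK (p : measurableTypeR R * 'rV[R]_N) : tail_rV (cons_rV p) = p.2.
  by apply/rowP => j; rewrite !mxE liftK.
by apply/seteqP; split=> p /=; rewrite tailK mxE unlift_none.
Qed.

HB.instance Definition _ :=
  Measure_isSigmaFinite.Build _ _ _ lebesgue_rV_step step_sigma_finite.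

End step.

Fixpoint lebesgue_rV (N : nat) : {sigma_finite_measure set 'rV[R]_N -> \bar R} :=
  match N with
  | 0 => \d_(0 : 'rV[R]_0)
  | N'.+1 => lebesgue_rV_step (lebesgue_rV N')
  end.

Lemma lebesgue_rV_box (N : nat) (B : 'I_N -> set R) :
  (forall i, measurable (B i)) ->
  lebesgue_rV N [set x | forall i, B i (x ord0 i)] =
  (\prod_(i < N) @lebesgue_measure R (B i))%E.
Proof.
elim: N B => [|N IH] B mB /=.
  by rewrite big_ord0 diracE mem_set// => -[].
rewrite big_ord_recl -IH; last by move=> i; exact: mB.
have mB' : measurable
    [set x : 'rV[R]_N | forall i, B (lift ord0 i) (x ord0 i)].
  rewrite (_ : [set _ | _] = \bigcap_(i in [set: 'I_N])
    ((fun x : 'rV[R]_N => x ord0 i) @^-1` B (lift ord0 i))); last first.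
    by apply/seteqP; split=> x xB i; [move=> _|]; exact: xB.
  apply: fin_bigcap_measurable => // i _.
  by have := measurable_coord_rV i measurableT (mB (lift ord0 i)); rewrite setTI.
rewrite -product_measure1E//; last exact: mB.
rewrite /lebesgue_rV_step /pushforward; congr (_ _).
apply/seteqP; split=> [[x y] /= xyB|[x y] /= [xB yB] i].
  split; first by have := xyB ord0; rewrite mxE unlift_none.
  by move=> i; have := xyB (lift ord0 i); rewrite mxE liftK.
by rewrite mxE; case: unliftP => [j|] -> /=.
Qed.

End lebesgue_rV.

(* The case y = x is explicit only for readability: the formula also evaluates
   to 0 there when N < alpha. *)
Definition log_riesz_kernel (R : realType) (N : nat) (alpha : R)
    (x y : 'rV[R]_N) : R :=
  if y == x then 0
  else enorm (x - y) `^ (alpha - N%:R) * ln (1 / enorm (x - y)).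

Definition log_riesz_potential (R : realType) (N : nat) (alpha : R)
    (Omega : set 'rV[R]_N) (x : 'rV[R]_N) : R :=
  Rintegral (lebesgue_rV R N) Omega (log_riesz_kernel alpha x).

(* Main.v *)
Require Import Defs.
From HB Require Import structures.
From mathcomp Require Import all_boot all_order all_algebra.
From mathcomp Require Import all_classical all_reals all_analysis.
From mathcomp Require Import measurable_realfun ring lra.
Import Order.TTheory GRing.Theory Num.Theory.
Import numFieldNormedType.Exports.
Local Open Scope classical_set_scope.
Local Open Scope ring_scope.
Set Implicit Arguments.
Unset Strict Implicit.
Unset Printing Implicit Defensive.

(** The proof moves planes, and asks of the boundary only that exterior points
    accumulate at each of its points.

    Put b = alpha - N > 0. The kernel is f(|x - y|) with
    f(r) = r^b log (1/r), and the bound on the diameter says that f increases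
    strictly up to r = diam Omega. Fix a unit vector e and call chord a segment
    parallel to e with both ends on the boundary. Let l be the supremum of the
    heights, measured along e, of the midpoints of chords. If l <= l', the
    mirror at height l' sends every point x of Omega above it into Omega
    ([cap_reflection]): otherwise the line through x along e would leave Omega
    below x before the mirror image and again above x, at the ends of a chord
    whose midpoint is above l'.

    By compactness ([critical_position]) the height l is attained by a limit of
    chords, which is either a chord [z, w] of positive length or a single point
    w at height l. In the first case let K(y) = f(|w - y|) - f(|z - y|), whose
    integral over Omega is u(w) - u(z) = 0. In the second case let K be the
    derivative of f(|w - y|) along e; its integral is at most 0, as a limit of
    difference quotients of u over shrinking chords
    ([tangential_integral_le0]). Both kernels change sign under the mirror at
    height l and are positive on the part of Omega below it. The points of Omega
    whose mirror image is in Omega therefore contribute 0 to the integral, and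
    all others are below the mirror, where K > 0: they form a null set
    ([antisymmetric_null]), which is empty because a missing mirror image would
    have exterior points nearby ([null_symmetric]). Hence Omega has a mirror of
    symmetry orthogonal to every e ([mirror_plane]).

    The limit of the difference quotients is the delicate point, since f' is
    unbounded at 0 when b <= 1. The quotients have no evident fixed integrable
    majorant, but they have majorants that are translates of
    |v|^(g - 1) 1_(|v| < 1) for some 0 < g < 1; their integrals are all equal, so
    that Fatou's lemma applies to the sum of the majorant and the quotient
    ([fatou_varying_majorant]).

    Finally, the mirrors of the coordinate directions compose to a point
    reflection with centre c; as Omega is bounded, all mirrors contain c, so
    Omega is a union of spheres centred at c; and the reflections of caps make
    it star-shaped about c ([ball_of_mirrors]). *)

(** * Lebesgue measure is invariant under translations and unique as such *)

Lemma measurable_preimage d1 d2 (T1 : measurableType d1) (T2 : measurableType d2)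
    (f : T1 -> T2) (A : set T2) :
  measurable_fun setT f -> measurable A -> measurable (f @^-1` A).
Proof. by move=> mf mA; rewrite -[X in measurable X]setTI; exact: mf. Qed.

Definition measure_preserving d (T : measurableType d) (R : realType)
    (mu : set T -> \bar R) (f : T -> T) : Prop :=
  measurable_fun setT f /\ forall A, measurable A -> mu (f @^-1` A) = mu A.

Lemma lebesgue_translation (R : realType) (a : R) :
  measure_preserving (@lebesgue_measure R) (fun x => x + a).
Proof.
have mf : measurable_fun setT 
    (fun x : measurableTypeR R => (x + a : measurableTypeR R)).
  exact: measurable_funD.
split=> // A mA; apply/esym.
pose nu := measure_function_pushforward__canonical__measure_function_Measure
  (@lebesgue_measure R) mf.
rewrite -[RHS]/(nu A).
apply: (lebesgue_measure_unique (mu := nu)) => // _ [[u v] _ <-] /=.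
rewrite /pushforward (_ : _ @^-1` _ = `]u - a, v - a]%classic); last first.
  by apply/seteqP; split=> x /=; rewrite !in_itv/= ltrBlDr lerBrDr.
by rewrite !lebesgue_measure_itv/= !lte_fin ltrD2r -!EFinB opprB addrA subrK.
Qed.

Lemma lebesgue_opp (R : realType) :
  measure_preserving (@lebesgue_measure R) -%R.
Proof.
have mf : measurable_fun setT (-%R : measurableTypeR R -> measurableTypeR R).
  exact: (@measurable_funN _ _ _ setT id).
split=> // A mA; apply/esym.
pose nu := measure_function_pushforward__canonical__measure_function_Measure
  (@lebesgue_measure R) mf.
rewrite -[RHS]/(nu A).
apply: (lebesgue_measure_unique (mu := nu)) => // _ [[u v] _ <-] /=.
rewrite /pushforward (_ : _ @^-1` _ = `[- v, - u[%classic); last first.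
  by apply/seteqP; split=> x /=; rewrite !in_itv/= lerNl ltrNr andbC.
by rewrite !lebesgue_measure_itv/= !lte_fin ltrN2 -!EFinB opprK addrC.
Qed.

Lemma measure_preserving_prod d1 d2 (T1 : measurableType d1)
    (T2 : measurableType d2) (R : realType)
    (m1 : {sigma_finite_measure set T1 -> \bar R})
    (m2 : {sigma_finite_measure set T2 -> \bar R}) (f : T1 -> T1) (g : T2 -> T2) :
  measure_preserving m1 f -> measure_preserving m2 g ->
  measure_preserving (m1 \x m2)%E (fun p => (f p.1, g p.2)).
Proof.
move=> [mf fP] [mg gP].
have mfg : measurable_fun setT (fun p : T1 * T2 => (f p.1, g p.2)).
  apply: measurable_fun_pair.
    exact: (measurableT_comp mf measurable_fst).
  exact: (measurableT_comp mg measurable_snd).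
split=> // A mA; apply/esym.
pose nu := measure_function_pushforward__canonical__measure_function_Measure
  (m1 \x m2)%E mfg.
rewrite -[RHS]/(nu A); apply: product_measure_unique => // B C mB mC.
rewrite /= /pushforward (_ : _ @^-1` _ = (f @^-1` B) `*` (g @^-1` C)) //.
have mfB : measurable (f @^-1` B) by exact: (measurable_preimage mf mB).
have mgC : measurable (g @^-1` C) by exact: (measurable_preimage mg mC).
by rewrite product_measure1E//; congr (_ * _)%E; [exact: fP|exact: gP].
Qed.

Section rV_invariance.
Variable R : realType.

Lemma measurable_addr_rV N (a : 'rV[R]_N) :
  measurable_fun [set: 'rV[R]_N] (fun x => x + a).
Proof.
apply: measurable_fun_rV => i; under eq_fun do rewrite mxE.
by apply: measurable_funD => //; exact: measurable_coord_rV.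
Qed.

Lemma measurable_oppr_rV N : measurable_fun [set: 'rV[R]_N] (-%R).
Proof.
apply: measurable_fun_rV => i; under eq_fun do rewrite mxE.
by apply: measurableT_comp => //; exact: measurable_coord_rV.
Qed.

(** The induction step that follows the recursive definition of [lebesgue_rV]:
    a map that acts separately on the first coordinate and on the others. *)
Lemma measure_preserving_rV_step N (f : 'rV[R]_N.+1 -> 'rV[R]_N.+1)
    (f1 : measurableTypeR R -> measurableTypeR R) (f2 : 'rV[R]_N -> 'rV[R]_N) :
  measurable_fun setT f ->
  (forall p, f (cons_rV p) = cons_rV (f1 p.1, f2 p.2)) ->
  measure_preserving (@lebesgue_measure R) f1 ->
  measure_preserving (lebesgue_rV R N) f2 ->
  measure_preserving (lebesgue_rV R N.+1) f.
Proof.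
move=> mf fE m1 m2; split=> // A mA.
have [_ prodP] := measure_preserving_prod m1 m2.
rewrite /= /lebesgue_rV_step /pushforward -[RHS]prodP; last first.
  exact: (measurable_preimage (@measurable_cons_rV R N) mA).
by congr (_ _); apply/seteqP; split=> p /=; rewrite fE.
Qed.

Lemma lebesgue_rV_translation N (a : 'rV[R]_N) :
  measure_preserving (lebesgue_rV R N) (fun x => x + a).
Proof.
elim: N a => [|N IH] a.
  split=> [|A _]; first exact: measurable_addr_rV.
  by congr (_ _); apply/seteqP; split=> x /=; rewrite !(thinmx0 x) thinmx0.
apply: (measure_preserving_rV_step (f1 := fun x => x + a ord0 ord0)
  (f2 := fun x => x + \row_j a ord0 (lift ord0 j))) => //.
- exact: measurable_addr_rV.
- move=> p; apply/rowP => i; rewrite !mxE.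
  by case: unliftP => [j|] -> //=; rewrite !mxE.
- exact: lebesgue_translation.
Qed.

Lemma lebesgue_rV_opp N : measure_preserving (lebesgue_rV R N) -%R.
Proof.
elim: N => [|N IH].
  split=> [|A _]; first exact: measurable_oppr_rV.
  by congr (_ _); apply/seteqP; split=> x /=; rewrite !(thinmx0 x) thinmx0.
apply: (measure_preserving_rV_step (f1 := -%R) (f2 := -%R)) => //.
- exact: measurable_oppr_rV.
- move=> p; apply/rowP => i; rewrite !mxE.
  by case: unliftP => [j|] _ //=; rewrite !mxE.
- exact: lebesgue_opp.
Qed.

(** Compute in two orders the measure of the pairs (x, y) with x in A and
    x + y in B, for nu in x and Lebesgue measure in y. Integrating first in y
    gives nu A * |B|; integrating first in x, after the translation
    x -> x - y, gives nu B * |- A|. *)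
Lemma translation_invariant_proportional N
    (nu : {sigma_finite_measure set 'rV[R]_N -> \bar R}) (A B : set 'rV[R]_N) :
  (forall a, measure_preserving nu (fun x => x + a)) ->
  measurable A -> measurable B ->
  (nu A * lebesgue_rV R N B = nu B * lebesgue_rV R N A)%E.
Proof.
move=> nuT mA mB; set lam := lebesgue_rV R N.
pose M := [set p : 'rV[R]_N * 'rV[R]_N | A p.1 /\ B (p.2 + p.1)].
have mM : measurable M.
  apply: measurableI.
    exact: (measurable_preimage measurable_fst mA).
  have madd : measurable_fun setT
      (fun p : 'rV[R]_N * 'rV[R]_N => p.2 + p.1).
    apply: measurable_fun_rV => i; under eq_fun do rewrite mxE.
    by apply: measurable_funD; apply: (measurableT_comp (measurable_coord_rV i)).
  exact: (measurable_preimage madd mB).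
have mtr a : measurable (((fun x => x + a) @^-1` A) : set 'rV[R]_N).
  exact: (measurable_preimage (measurable_addr_rV a) mA).
have E1 : ((nu \x lam) M = nu A * lam B)%E.
  rewrite -product_measure1E //; apply: eq_integral => x _ /=.
  rewrite /xsection /=.
  have [Ax|nAx] := pselect (A x); last first.
    by congr (_ _); apply/seteqP; split=> y; rewrite /= !inE => -[].
  rewrite -[LHS]/(lam _).
  rewrite (_ : [set y | _] = (fun y => y + x) @^-1` B); last first.
    by apply/seteqP; split=> y; rewrite /= !inE => // -[].
  rewrite (lebesgue_rV_translation x).2//; congr (_ _).
  by apply/seteqP; split=> y; rewrite /= !inE => // -[].
have E2 : ((nu \x^ lam) M = nu B * lam A)%E.
  have [_ lamN] := lebesgue_rV_opp N.
  rewrite /product_measure2.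
  transitivity (\int[lam]_y nu ((fun x => (x - y)%R) @^-1` A `&` B))%E.
    apply: eq_integral => y _ /=; rewrite -[RHS](nuT y).2; last first.
      by apply: measurableI => //; exact: mtr.
    by congr (_ _); rewrite /ysection; apply/seteqP; split=> x;
      rewrite /= !inE/= addrK addrC.
  pose M' := [set p : 'rV[R]_N * 'rV[R]_N | A (p.1 - p.2) /\ B p.1].
  have mM' : measurable M'.
    apply: measurableI; last first.
      exact: (measurable_preimage measurable_fst mB).
    have msub : measurable_fun setT
        (fun p : 'rV[R]_N * 'rV[R]_N => p.1 - p.2).
      apply: measurable_fun_rV => i; under eq_fun do rewrite !mxE.
      by apply: measurable_funB;
        apply: (measurableT_comp (measurable_coord_rV i)).
    exact: (measurable_preimage msub mA).
  transitivity ((nu \x^ lam)%E M').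
    apply: eq_integral => y _ /=; congr (_ _).
    by rewrite /ysection; apply/seteqP; split=> x; rewrite /= !inE.
  transitivity ((nu \x lam)%E M').
    apply/esym/product_measure_unique => // C D mC mD /=.
    by rewrite product_measure2E.
  rewrite -product_measure1E //; apply: eq_integral => x _ /=.
  rewrite /xsection /=.
  have [Bx|nBx] := pselect (B x); last first.
    by congr (_ _); apply/seteqP; split=> y; rewrite /= !inE => -[].
  rewrite -[LHS]/(lam _) -[RHS]/(lam _).
  rewrite (_ : [set y | (x, y) \in M'] =
      (-%R) @^-1` ((fun y => y + x) @^-1` A)); last first.
    by apply/seteqP; split=> y; rewrite /= !inE /M'/= addrC => // -[].
  rewrite lamN// (lebesgue_rV_translation x).2//; congr (_ _).
  by apply/seteqP; split=> y; rewrite /= !inE => // -[].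
rewrite -E1 -E2.
by apply: product_measure_unique => // C D mC mD /=; rewrite product_measure2E.
Qed.

End rV_invariance.

(** * Euclidean geometry of row vectors *)

Section euclidean.
Variables (R : realType) (N : nat).
Implicit Types x y z e : 'rV[R]_N.

Definition dot x y : R := \sum_(i < N) x ord0 i * y ord0 i.

Lemma dotC x y : dot x y = dot y x.
Proof. by apply: eq_bigr => i _; rewrite mulrC. Qed.

Lemma dotDl x y z : dot (x + y) z = dot x z + dot y z.
Proof.
by rewrite -big_split; apply: eq_bigr => i _; rewrite mxE mulrDl.
Qed.

Lemma dotZl a x z : dot (a *: x) z = a * dot x z.
Proof.
by rewrite mulr_sumr; apply: eq_bigr => i _; rewrite mxE mulrA.
Qed.

Lemma dotNl x z : dot (- x) z = - dot x z.
Proof. by rewrite -scaleN1r dotZl mulN1r. Qed.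

Lemma dotDr x y z : dot z (x + y) = dot z x + dot z y.
Proof. by rewrite dotC dotDl !(dotC z). Qed.

Lemma dotZr a x z : dot z (a *: x) = a * dot z x.
Proof. by rewrite dotC dotZl (dotC z). Qed.

Lemma dotNr x z : dot z (- x) = - dot z x.
Proof. by rewrite dotC dotNl (dotC z). Qed.

Definition dotE := (dotDl, dotDr, dotNl, dotNr, dotZl, dotZr).

Lemma dot0l x : dot 0 x = 0.
Proof. by rewrite -(scale0r x) dotZl mul0r. Qed.

Lemma dot_ge0 x : 0 <= dot x x.
Proof. by apply: sumr_ge0 => i _; rewrite -expr2 sqr_ge0. Qed.

Lemma enormE x : enorm x = Num.sqrt (dot x x).
Proof. by congr Num.sqrt; apply: eq_bigr => i _; rewrite expr2. Qed.

Lemma enorm_ge0 x : 0 <= enorm x.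
Proof. exact: sqrtr_ge0. Qed.

Lemma sqr_enorm x : enorm x ^+ 2 = dot x x.
Proof. by rewrite enormE sqr_sqrtr // dot_ge0. Qed.

Lemma coord_le_enorm x i : `|x ord0 i| <= enorm x.
Proof.
rewrite -sqrtr_sqr ler_wsqrtr // (bigD1 i) //= lerDl.
by apply: sumr_ge0 => j _; rewrite sqr_ge0.
Qed.

Lemma enorm_eq0 x : enorm x = 0 -> x = 0.
Proof.
move=> x0; apply/rowP => i; rewrite mxE; apply/eqP; rewrite -normr_le0 -x0.
exact: coord_le_enorm.
Qed.

Lemma enorm_gt0 x : x != 0 -> 0 < enorm x.
Proof.
by move=> x0; rewrite lt_def enorm_ge0 andbT; apply: contra_neq x0 => /enorm_eq0.
Qed.

Lemma enorm0 : enorm (0 : 'rV[R]_N) = 0.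
Proof. by rewrite enormE dot0l sqrtr0. Qed.

Lemma enormN x : enorm (- x) = enorm x.
Proof. by rewrite !enormE !dotE opprK. Qed.

Lemma enormB x y : enorm (x - y) = enorm (y - x).
Proof. by rewrite -enormN opprB. Qed.

Lemma enormZ a x : enorm (a *: x) = `|a| * enorm x.
Proof.
by rewrite !enormE !dotE mulrA -expr2 sqrtrM ?sqr_ge0// sqrtr_sqr.
Qed.

Lemma dot_le_enorm x y : dot x y <= enorm x * enorm y.
Proof.
have [->|x0] := eqVneq x 0; first by rewrite dot0l mulr_ge0 ?enorm_ge0.
have [->|y0] := eqVneq y 0; first by rewrite dotC dot0l mulr_ge0 ?enorm_ge0.
have := dot_ge0 (enorm y *: x - enorm x *: y).
have px := enorm_gt0 x0; have py := enorm_gt0 y0.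
rewrite !dotE -!sqr_enorm (dotC y x).
rewrite (_ : _ + _ =
    2 * (enorm x * enorm y) * (enorm x * enorm y - dot x y)); last by ring.
by rewrite pmulr_rge0 ?subr_ge0// !mulr_gt0.
Qed.

Lemma enormD x y : enorm (x + y) <= enorm x + enorm y.
Proof.
rewrite -(@ler_pXn2r _ 2) ?nnegrE ?addr_ge0 ?enorm_ge0//.
have := dot_le_enorm x y.
by rewrite sqrrD !sqr_enorm !dotE (dotC y x); lra.
Qed.

Lemma enorm_dist x y z : `|enorm (x - z) - enorm (y - z)| <= enorm (x - y).
Proof.
have h a b : enorm (a - z) - enorm (b - z) <= enorm (a - b).
  by rewrite lerBlDr (le_trans _ (enormD _ _))// addrA subrK.
rewrite ler_norml; apply/andP; split; last exact: h.
by rewrite lerNl opprB (enormB x y); exact: h.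
Qed.

Lemma enorm_le_norm x : enorm x <= N%:R * `|x|.
Proof.
have xi i : `|x ord0 i| <= `|x|.
  by rewrite [leRHS]/Num.norm /= mx_normrE; apply/bigmax_geP; right; exists (ord0, i).
have h : enorm x <= \sum_(i < N) `|x ord0 i|.
  rewrite -(@ler_pXn2r _ 2) ?nnegrE ?enorm_ge0 ?sumr_ge0// sqr_enorm expr2.
  rewrite mulr_suml; apply: ler_sum => i _; apply: le_trans (ler_norm _) _.
  by rewrite normrM ler_wpM2l// (bigD1 i)//= lerDl sumr_ge0.
apply: le_trans h _; apply: le_trans (ler_sum _ (fun i _ => xi i)) _.
by rewrite sumr_const card_ord mulr_natl.
Qed.

Lemma norm_le_enorm x : `|x| <= enorm x.
Proof.
rewrite [leLHS]/Num.norm /= mx_normrE; apply/bigmax_leP => /=.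
split=> [|[i j] _ /=]; first exact: enorm_ge0.
by rewrite (ord1 i) coord_le_enorm.
Qed.

(** For a unit vector [e], the mirror image of [x] in the hyperplane of the
    points at height [l] along [e]. *)
Definition reflection e (l : R) x := x - (2 * (dot x e - l)) *: e.

Lemma dot_reflection e l x :
  dot e e = 1 -> dot (reflection e l x) e = 2 * l - dot x e.
Proof. by move=> e1; rewrite !dotE e1; ring. Qed.

Lemma reflectionK e l : dot e e = 1 -> involutive (reflection e l).
Proof.
move=> e1 x; rewrite {1}/reflection dot_reflection//; apply/rowP => i.
by rewrite !mxE; ring.
Qed.

Lemma reflectionB e l x y :
  reflection e l x - reflection e l y = reflection e 0 (x - y).
Proof.
apply/rowP => i; rewrite /reflection !mxE !dotE; ring.
Qed.

Lemma enorm_reflection0 e x : dot e e = 1 -> enorm (reflection e 0 x) = enorm x.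
Proof.
by move=> e1; rewrite !enormE !dotE e1 (dotC e x); congr Num.sqrt; ring.
Qed.

Lemma enorm_reflection e l x y : dot e e = 1 ->
  enorm (reflection e l x - reflection e l y) = enorm (x - y).
Proof. by move=> e1; rewrite reflectionB enorm_reflection0. Qed.

Lemma enorm_reflectionl e l x y : dot e e = 1 ->
  enorm (reflection e l x - y) = enorm (x - reflection e l y).
Proof.
by move=> e1; rewrite -{1}(reflectionK l e1 y) enorm_reflection.
Qed.

(** The topology of ['rV[R]_N] comes from the sup norm, which the Euclidean norm
    dominates. *)
Lemma cvg_rV_enorm (T : Type) (F : set_system T) {FF : Filter F}
   (f : T -> 'rV[R]_N) (x : 'rV[R]_N) :
  enorm (f t - x) @[t --> F] --> 0 -> f t @[t --> F] --> x.
Proof.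
move=> /cvgr0_norm_lt fx; apply/cvgrPdist_lt => d /fx; apply: filterS => t.
rewrite ger0_norm ?enorm_ge0// distrC; exact: le_lt_trans (norm_le_enorm _).
Qed.

Lemma normr_dot_le x y : `|dot x y| <= enorm x * enorm y.
Proof.
rewrite ler_norml dot_le_enorm andbT lerNl -dotNl (le_trans (dot_le_enorm _ _))//.
by rewrite enormN.
Qed.

(** The converse comparison, by a factor [N], makes a function that is Lipschitz
    for the Euclidean norm continuous. *)
Lemma continuous_of_enorm_lipschitz (k : R) (f : 'rV[R]_N -> R) :
  (forall x y, `|f x - f y| <= k * enorm (x - y)) -> continuous f.
Proof.
move=> fk x; apply/(@cvgrPdist_lt _ _ _ _ (nbhs_filter x)) => d d0.
have C0 : 0 < (`|k| + 1) * N.+1%:R by rewrite mulr_gt0// ltr_wpDl.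
apply/nbhs_ballP; exists (d / ((`|k| + 1) * N.+1%:R)); first exact: divr_gt0.
move=> y; rewrite -ball_normE /= ltr_pdivlMr// mulrC => xy.
apply: le_lt_trans (fk _ _) _; apply: le_lt_trans xy; rewrite -mulrA.
apply: (@le_trans _ _ ((`|k| + 1) * enorm (x - y))).
  by rewrite ler_wpM2r ?enorm_ge0// (le_trans (ler_norm _))// lerDl.
rewrite ler_wpM2l ?addr_ge0// (le_trans (enorm_le_norm _))//.
by rewrite ler_wpM2r// ler_nat.
Qed.

Lemma continuous_dotl e : continuous (fun x => dot x e).
Proof.
apply: (@continuous_of_enorm_lipschitz (enorm e)) => x y.
by rewrite -dotNl -dotDl mulrC normr_dot_le.
Qed.

Lemma continuous_enorm : continuous (@enorm R N).
Proof.
apply: (@continuous_of_enorm_lipschitz 1) => x y; rewrite mul1r.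
by have := enorm_dist x y 0; rewrite !subr0.
Qed.

Lemma continuous_dist z : continuous (fun x => enorm (x - z)).
Proof.
apply: (@continuous_of_enorm_lipschitz 1) => x y; rewrite mul1r.
exact: enorm_dist.
Qed.

Lemma continuous_reflection e l : dot e e = 1 -> continuous (reflection e l).
Proof.
move=> e1 x; apply: (@cvg_rV_enorm _ _ (nbhs_filter x)).
have -> : (fun t => enorm (reflection e l t - reflection e l x)) =
    (fun t => enorm (t - x)) by apply/funext => t; rewrite enorm_reflection.
by have := @continuous_dist x x; rewrite /continuous_at subrr enorm0.
Qed.

End euclidean.

(** * Measure of open sets and invariance under reflections *)

Section sigma_finite_copy.
Context d (T : measurableType d) (R : realType).
Variables (mu : {measure set T -> \bar R}) (sf : sigma_finite setT mu).

(** Carries the proof of sigma-finiteness in its type, where structure inference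
    can find it. *)
Definition sigma_finite_copy of sigma_finite setT mu : set T -> \bar R := mu.

HB.instance Definition _ := Measure.on (sigma_finite_copy sf).
HB.instance Definition _ :=
  Measure_isSigmaFinite.Build _ _ _ (sigma_finite_copy sf) sf.

Definition sigma_finite_pack : {sigma_finite_measure set T -> \bar R} :=
  sigma_finite_copy sf.

End sigma_finite_copy.

Section measurable_open.
Variables (R : realType) (N : nat).
Implicit Types (A : set 'rV[R]_N) (x y : 'rV[R]_N).

Lemma measurable_box_rV (B : 'I_N -> set R) : (forall i, measurable (B i)) ->
  measurable [set x : 'rV[R]_N | forall i, B i (x ord0 i)].
Proof.
move=> mB; rewrite (_ : [set _ | _] = \bigcap_(i in [set: 'I_N])
    ((fun x : 'rV[R]_N => x ord0 i) @^-1` B i)); last first.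
  by apply/seteqP; split=> x xB i; [move=> _|]; exact: xB.
apply: fin_bigcap_measurable => // i _.
exact: measurable_preimage (measurable_coord_rV i) (mB i).
Qed.

Lemma open_rV_box A x : open A -> A x -> exists2 d : R, 0 < d &
  forall y, (forall i, `|y ord0 i - x ord0 i| < d) -> A y.
Proof.
move=> oA Ax; have /nbhs_ballP[d /= d0 dA] := open_nbhs_nbhs (conj oA Ax).
exists d => // y yx; apply: dA; rewrite /ball/= /mx_ball; split=> // i j.
by rewrite (ord1 i) /ball/= distrC.
Qed.

(** An open set is the union of the boxes with rational corners that it
    contains. *)
Lemma measurable_open_rV A : open A -> measurable A.
Proof.
move=> oA.
pose box (p : 'rV[rat]_N * 'rV[rat]_N) : set 'rV[R]_N := [set x | forall i,
  `]ratr (p.1 ord0 i), ratr (p.2 ord0 i)[%classic (x ord0 i)].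
have mbox p : measurable (box p).
  by apply: (@measurable_box_rV
    (fun i => `]ratr (p.1 ord0 i), ratr (p.2 ord0 i)[%classic)) => i.
have -> : A = \bigcup_(p in [set p | box p `<=` A]) box p.
  apply/seteqP; split=> [x Ax|x [p pA]]; last exact: pA.
  have [d d0 dA] := open_rV_box oA Ax.
  have lo i : exists q : rat, x ord0 i - d < ratr q < x ord0 i.
    have h : x ord0 i - d < x ord0 i by lra.
    have [q] := rat_in_itvoo h.
    by rewrite in_itv/=; exists q.
  have hi i : exists q : rat, x ord0 i < ratr q < x ord0 i + d.
    have h : x ord0 i < x ord0 i + d by lra.
    have [q] := rat_in_itvoo h.
    by rewrite in_itv/=; exists q.
  have [a aP] := choice lo; have [b bP] := choice hi.
  exists (\row_i a i, \row_i b i).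
    move=> y yab; apply: dA => i; have /= := yab i.
    rewrite in_itv/= !mxE => /andP[h1 h2].
    have /andP[h3 h4] := aP i; have /andP[h5 h6] := bP i.
    by rewrite ltr_norml; apply/andP; split; lra.
  move=> i /=; rewrite in_itv/= !mxE.
  by have /andP[_ ->] := aP i; have /andP[->] := bP i.
rewrite bigcup_mkcond; apply: countable_bigcupT_measurable => // p.
by case: ifPn.
Qed.

Lemma measurable_dot (e : 'rV[R]_N) : measurable_fun setT (fun x => dot x e).
Proof.
apply: measurable_sum => i; apply: measurable_funM => //.
exact: measurable_coord_rV.
Qed.

Lemma measurable_enorm : measurable_fun setT (@enorm R N).
Proof.
apply: (measurableT_comp (f := @Num.sqrt R)).
  apply: continuous_measurable_fun; exact: sqrt_continuous.
apply: measurable_sum => i; apply: measurable_funX.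
exact: measurable_coord_rV.
Qed.

Lemma measurable_dist x : measurable_fun setT (fun y => enorm (x - y)).
Proof.
apply: (measurableT_comp measurable_enorm).
under eq_fun do rewrite addrC.
exact: (measurableT_comp (measurable_addr_rV x) (@measurable_oppr_rV R N)).
Qed.

Lemma measurable_reflection e l : measurable_fun setT (@reflection R N e l).
Proof.
apply: measurable_fun_rV => i; under eq_fun do rewrite !mxE.
apply: measurable_funB; first exact: measurable_coord_rV.
apply: measurable_funM => //; apply: measurable_funM => //.
by apply: measurable_funB => //; exact: measurable_dot.
Qed.

Lemma lebesgue_open_gt0 A : open A -> A !=set0 -> (0 < lebesgue_rV R N A)%E.
Proof.
move=> oA [x Ax]; have [d d0 dA] := open_rV_box oA Ax.
pose B i : set R := `]x ord0 i - d, x ord0 i + d[%classic.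
have mB i : measurable (B i) by exact: measurable_itv.
apply: (@lt_le_trans _ _ (lebesgue_rV R N [set y | forall i, B i (y ord0 i)])).
  rewrite lebesgue_rV_box//; apply: (big_ind (fun a => 0 < a)%E) => //.
    by move=> a b a0 b0; rewrite mule_gt0.
  move=> i _; rewrite lebesgue_measure_itv/= lte_fin.
  rewrite ifT; last by lra.
  by rewrite -EFinB lte_fin; lra.
apply: le_measure; rewrite ?inE.
- exact: (measurable_box_rV mB).
- exact: measurable_open_rV.
- move=> y yB; apply: dA => i; have := yB i; rewrite /B/= in_itv/= => /andP[? ?].
  by rewrite ltr_norml; apply/andP; split; lra.
Qed.

Lemma lebesgue_bounded_lty A : measurable A ->
  (exists M, forall x, A x -> enorm x <= M) -> (lebesgue_rV R N A < +oo)%E.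
Proof.
move=> mA [M AM].
pose B (i : 'I_N) : set R := `[- M, M]%classic.
have mB i : measurable (B i) by exact: measurable_itv.
apply: (@le_lt_trans _ _ (lebesgue_rV R N [set y | forall i, B i (y ord0 i)])).
  apply: le_measure; rewrite ?inE//.
    exact: (measurable_box_rV mB).
  move=> x Ax i; rewrite /B/= in_itv/= -ler_norml.
  exact: le_trans (coord_le_enorm _ _) (AM _ Ax).
rewrite lebesgue_rV_box//.
rewrite (_ : (\prod_(i < N) _)%E =
    (\prod_(i < N) (fine (lebesgue_measure (B i))))%:E).
  exact: ltry.
rewrite -prodEFin; apply: eq_bigr => i _; rewrite fineK//.
rewrite /B lebesgue_measure_itv/=; case: ifP => //.
Qed.

Lemma open_eball c r : open (@eball R N c r).
Proof.
rewrite (_ : eball c r = (fun x => enorm (x - c)) @^-1` [set x | x < r]) //.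
by apply: open_comp => // x _; exact: continuous_dist.
Qed.

Lemma measurable_eball c r : measurable (@eball R N c r).
Proof. exact: (measurable_open_rV (open_eball (c := c) (r := r))). Qed.

Lemma lebesgue_eball_lty c r : (lebesgue_rV R N (eball c r) < +oo)%E.
Proof.
apply: lebesgue_bounded_lty; first exact: measurable_eball.
exists (r + enorm c) => x; rewrite /eball/= => xr.
by rewrite -(subrK c x) (le_trans (enormD _ _))// lerD2r ltW.
Qed.

(** The image of Lebesgue measure under a reflection is translation invariant,
    hence proportional to Lebesgue measure; a ball centred on the mirror is its
    own image, so that the factor is 1. *)
Lemma lebesgue_reflection e l : dot e e = 1 ->
  measure_preserving (lebesgue_rV R N) (reflection e l).
Proof.
move=> e1; split=> [|A mA]; first exact: measurable_reflection.
pose c := l *: e.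
have cK : reflection e l c = c.
  by rewrite /reflection /c dotZl e1 mulr1 subrr mulr0 scale0r subr0.
have ballE r : reflection e l @^-1` eball c r = eball c r.
  have dc x : enorm (reflection e l x - c) = enorm (x - c).
    by rewrite -{1}cK enorm_reflection.
  by apply/seteqP; split=> x; rewrite /eball/= dc.
pose nu0 := measure_function_pushforward__canonical__measure_function_Measure
  (lebesgue_rV R N) (@measurable_reflection e l).
have sf : sigma_finite setT nu0.
  exists (fun n : nat => eball c n%:R).
    apply/esym; rewrite -subTset => x _.
    exists (Num.truncn (enorm (x - c))).+1 => //.
    exact: truncnS_gt.
  move=> n; split; first exact: measurable_eball.
  by rewrite /= /pushforward ballE lebesgue_eball_lty.
pose nu := sigma_finite_pack sf.
have nuT a : measure_preserving nu (fun x => x + a).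
  split=> [|B mB]; first exact: measurable_addr_rV.
  have [_ T] := lebesgue_rV_translation (reflection e 0 a).
  rewrite -[LHS]/(lebesgue_rV R N _) -[RHS]/(lebesgue_rV R N _) -[RHS]T; last first.
    exact: measurable_preimage (measurable_reflection e l) mB.
  congr (_ _); apply/seteqP; split=> x /=;
    rewrite (_ : reflection e l (x + _) = reflection e l x + a)//;
    rewrite -{2}(reflectionK 0 e1 a);
    by apply/rowP => i; rewrite /reflection !mxE !dotE; ring.
have := translation_invariant_proportional nuT mA (measurable_eball c 1).
rewrite -![nu _]/(lebesgue_rV R N _) ballE => h.
have b_gt0 : (0 < lebesgue_rV R N (eball c 1))%E.
  apply: lebesgue_open_gt0; first exact: open_eball.
  by exists c; rewrite /eball/= subrr enorm0.
have b_lty := lebesgue_eball_lty c 1.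
have b_fin : lebesgue_rV R N (eball c 1) \is a fin_num by rewrite gt0_fin_numE.
have r0 : fine (lebesgue_rV R N (eball c 1)) != 0.
  by rewrite gt_eqF// fine_gt0// b_gt0.
apply/esym/eqP; rewrite -[X in X == _]mul1e.
rewrite -(mulVf r0) EFinM -muleA eqe_pdivrMl// fineK//.
by apply/eqP; rewrite -h muleC.
Qed.

End measurable_open.

(** * The radial profile of the kernel *)

Section profile.
Variables (R : realType) (b : R).
Hypothesis b_gt0 : 0 < b.
Implicit Types r s : R.

Definition profile r : R := r `^ b * ln (1 / r).

(** The derivative of [profile]. *)
Definition dprofile r : R := - (r `^ (b - 1) * (b * ln r + 1)).

Lemma profileE r : profile r = - (r `^ b * ln r).
Proof.
rewrite /profile div1r; have [r0|r0] := leP r 0; last by rewrite lnV ?mulrN.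
by rewrite !ln0 ?mulr0 ?oppr0// invr_le0.
Qed.

Lemma is_derive_profile r : 0 < r -> is_derive r 1 profile (dprofile r).
Proof.
move=> r0; rewrite (_ : profile = - ((@powR R ^~ b) * @ln R)); last first.
  by apply/funext => a; rewrite profileE.
apply: is_derive_eq.
  apply: is_deriveN; apply: is_deriveM; first exact: is_derive1_powR.
  exact: is_derive1_ln.
rewrite /dprofile /GRing.scale/= mulrDr mulr1 mulrCA addrC.
congr (- (_ + _)); first by ring.
rewrite powRB; last by rewrite (lt0r_neq0 r0) implybT.
by rewrite powRr1 ?ltW.
Qed.

(** The radius [expR (- b^-1)] of the diameter bound is the zero of the
    derivative of the profile. *)
Lemma lt_expRN_ln r : 0 < r -> r < expR (- b^-1) -> b * ln r + 1 < 0.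
Proof.
move=> r0; rewrite -{1}(lnK r0) ltr_expR => h.
rewrite -ltrBrDr sub0r -(ltr_pM2l (x := b^-1)) ?invr_gt0//.
by rewrite mulKf ?gt_eqF// mulrN1.
Qed.

Lemma dprofile_gt0 r : 0 < r -> r < expR (- b^-1) -> 0 < dprofile r.
Proof.
move=> r0 /(lt_expRN_ln r0) h.
by rewrite /dprofile -mulrN mulr_gt0 ?powR_gt0// oppr_gt0.
Qed.

Lemma lt_expRN_1 r : r < expR (- b^-1) -> r < 1.
Proof.
move=> h; apply: lt_trans h _; rewrite -expR0 ltr_expR oppr_lt0 invr_gt0 //.
Qed.

(** Since log s < s for s = r^(- d): the logarithm costs an arbitrarily small
    power. *)
Lemma powR_lnN_le d r : 0 < d -> 0 < r -> r < 1 -> r `^ d * - ln r <= d^-1.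
Proof.
move=> d0 r0 r1.
have p0 : 0 < r `^ d by exact: powR_gt0.
rewrite mulrC -ler_pdivlMr// -invfM -(ler_pM2l d0).
rewrite invfM mulrA divff ?gt_eqF// mul1r.
rewrite mulrN -ln_powR -lnV ?posrE//.
by apply/ltW/ln_sublinear; rewrite invr_gt0.
Qed.

Lemma profile_ge0 r : r < 1 -> 0 <= profile r.
Proof.
move=> r1; have [r0|r0] := leP r 0; last first.
  rewrite profileE -mulrN mulr_ge0 ?powR_ge0// oppr_ge0 ln_le0//; exact: ltW.
by rewrite profileE (ln0 r0) mulr0 oppr0.
Qed.

Lemma profile_le r : r < 1 -> profile r <= b^-1.
Proof.
move=> r1; have [r0|r0] := leP r 0; last first.
  by rewrite profileE -mulrN powR_lnN_le.
by rewrite profileE (ln0 r0) mulr0 oppr0 invr_ge0 ltW.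
Qed.

(** Any exponent in (0, 1) that is smaller than [b] and stays away from it
    would do to absorb the logarithm in the derivative of the profile. *)
Definition majorant_exponent : R := Num.min b 1 / 2.
Let g := majorant_exponent.

Lemma majorant_exponent_gt0 : 0 < g.
Proof. by rewrite divr_gt0// lt_min b_gt0 ltr01. Qed.

Lemma majorant_exponent_lt1 : g < 1.
Proof.
rewrite ltr_pdivrMr// mul1r (@le_lt_trans _ _ 1)//; last by rewrite ltr1n.
by rewrite ge_min lexx orbT.
Qed.

Lemma majorant_exponent_le : g <= b / 2.
Proof. by rewrite ler_pM2r ?invr_gt0// ge_min lexx. Qed.

(** Write r^(b - 1) as r^(g - 1) r^(b - g); as b - g >= b / 2, the second factor
    absorbs b log (1/r) at the cost of the constant 2. *)
Lemma dprofile_le r : 0 < r -> r < 1 -> dprofile r <= 2 * r `^ (g - 1).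
Proof.
move=> r0 r1.
have gb := majorant_exponent_le.
have d0 : 0 < b - g by have := b_gt0; lra.
have h := powR_lnN_le d0 r0 r1.
have p0 := powR_gt0 (g - 1) r0; have q0 := powR_gt0 (b - g) r0.
rewrite /dprofile (_ : b - 1 = (b - g) + (g - 1)); last by ring.
rewrite powRD ?(lt0r_neq0 r0) ?implybT// [leRHS]mulrC.
rewrite (_ : - _ = r `^ (g - 1) * (r `^ (b - g) * (- (b * ln r) - 1))); last by ring.
rewrite ler_pM2l// mulrDr.
have h1 : b * (r `^ (b - g) * - ln r) <= 2.
  apply: le_trans (ler_wpM2l (ltW b_gt0) h) _.
  rewrite ler_pdivrMr//; lra.
lra.
Qed.

Lemma profile_MVT s r : 0 < s -> s <= r ->
  exists2 x, s <= x <= r & profile r - profile s = dprofile x * (r - s).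
Proof.
move=> s0 sr; have [| |x] := @MVT_segment R profile dprofile s r sr.
- move=> x; rewrite in_itv/= => /andP[sx _]; apply: is_derive_profile.
  exact: lt_trans sx.
- apply: derivable_within_continuous => x; rewrite in_itv/= => /andP[sx _].
  have [//] := is_derive_profile (lt_le_trans s0 sx).
- by rewrite in_itv /=; exists x.
Qed.

Lemma profile_increasing D s r : D < expR (- b^-1) -> 0 < s -> s < r -> r <= D ->
  profile s < profile r.
Proof.
move=> D1 s0 sr rD; have [x /andP[sx xr] h] := profile_MVT s0 (ltW sr).
rewrite -subr_gt0 h mulr_gt0 ?subr_gt0//; apply: dprofile_gt0.
  exact: lt_le_trans sx.
by apply: le_lt_trans D1; apply: le_trans rD.
Qed.

(** By the mean value theorem, the bound on the derivative being decreasing;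
    the smaller of the two radii is not known, so that both powers appear. *)
Lemma profile_lipschitz D s r : D < expR (- b^-1) -> 0 < s -> 0 < r ->
  s <= D -> r <= D ->
  `|profile r - profile s| <= 2 * (s `^ (g - 1) + r `^ (g - 1)) * `|r - s|.
Proof.
move=> D1; wlog sr : s r / s <= r.
  move=> H s0 r0 sD rD; have [/H|/ltW/H] := leP s r; first exact.
  by move=> /(_ r0 s0 rD sD); rewrite distrC (distrC s) (addrC (r `^ _)).
move=> s0 r0 _ rD.
have [x /andP[sx xr] ->] := profile_MVT s0 sr.
have x0 := lt_le_trans s0 sx.
have xD : x < expR (- b^-1) by apply: le_lt_trans D1; apply: le_trans rD.
rewrite normrM ler_wpM2r//.
rewrite gtr0_norm ?dprofile_gt0//.
apply: le_trans (dprofile_le x0 (lt_expRN_1 xD)) _.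
rewrite ler_wpM2l// (@le_trans _ _ (s `^ (g - 1)))//; last first.
  by rewrite lerDl powR_ge0.
rewrite -(opprB 1 g) !powRN lef_pV2 ?posrE ?powR_gt0//.
apply: ge0_ler_powR => //; rewrite ?nnegrE ?ltW//.
by rewrite subr_gt0 majorant_exponent_lt1.
Qed.

Lemma continuous_dprofile r : 0 < r -> {for r, continuous dprofile}.
Proof.
move=> r0; apply: cvgN; apply: cvgM.
  have [/derivable1_diffP d _] := is_derive1_powR (b - 1) r0.
  exact: (differentiable_continuous d).
apply: cvgD; last exact: cvg_cst.
by apply: cvgMl_tmp; exact: continuous_ln.
Qed.

Lemma measurable_profile : measurable_fun setT profile.
Proof.
rewrite (_ : profile = fun r => - (r `^ b * ln r)); last first.
  by apply/funext => r; rewrite profileE.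
apply: measurable_funN; apply: measurable_funM; first exact: measurable_powR.
exact: measurable_ln.
Qed.

Lemma measurable_dprofile : measurable_fun setT dprofile.
Proof.
apply: measurable_funN; apply: measurable_funM; first exact: measurable_powR.
apply: measurable_funD => //; apply: measurable_funM => //; exact: measurable_ln.
Qed.

End profile.

(** * Change of variables and integrability of a singular power *)

Section preserving_integral.
Context d (T : measurableType d) (R : realType).
Variables (mu : {measure set T -> \bar R}) (phi : T -> T).
Hypothesis mp : measure_preserving mu phi.
Local Open Scope ereal_scope.

Let mphi := mp.1.

Let pushE (D : set T) (f : T -> \bar R) :
  \int[pushforward mu phi]_(y in D) f y = \int[mu]_(y in D) f y.
Proof.
pose nu := measure_function_pushforward__canonical__measure_function_Measure mu mphi.
rewrite -[LHS]/(\int[nu]_(y in D) f y).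
by apply: eq_measure_integral => A mA _; exact: (mp.2 _ mA).
Qed.

Lemma ge0_integral_preserving (f : T -> \bar R) :
  measurable_fun setT f -> (forall y, 0 <= f y) ->
  \int[mu]_y f (phi y) = \int[mu]_y f y.
Proof.
by move=> mf f0; rewrite -[RHS]pushE ge0_integral_pushforward.
Qed.

Lemma integral_preserving (D : set T) (f : T -> \bar R) :
  measurable D -> measurable_fun setT f ->
  mu.-integrable (phi @^-1` D) (f \o phi) ->
  \int[mu]_(y in phi @^-1` D) f (phi y) = \int[mu]_(y in D) f y.
Proof. by move=> mD mf fi; rewrite -[RHS]pushE integral_pushforward. Qed.

End preserving_integral.

Lemma measure_preserving_comp d (T : measurableType d) (R : realType)
    (mu : set T -> \bar R) (f g : T -> T) :
  measure_preserving mu f -> measure_preserving mu g ->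
  measure_preserving mu (f \o g).
Proof.
move=> [mf fP] [mg gP]; split; first exact: measurableT_comp.
by move=> A mA; rewrite comp_preimage gP ?fP//; exact: measurable_preimage.
Qed.

Section singular_integrable.
Variables (R : realType) (N : nat) (s : R).
Hypotheses (N_gt0 : (0 < N)%N) (s_gtN1 : -1 < s) (s_lt0 : s < 0).

Definition singular_majorant (v : 'rV[R]_N) : R :=
  if enorm v < 1 then enorm v `^ s else 0.

Lemma singular_majorant_ge0 v : 0 <= singular_majorant v.
Proof. by rewrite /singular_majorant; case: ifP => // _; exact: powR_ge0. Qed.

Lemma measurable_singular_majorant : measurable_fun setT singular_majorant.
Proof.
apply: measurable_fun_ifT => //.
  by apply: measurable_fun_ltr => //; exact: measurable_enorm.
by apply: (measurableT_comp (measurable_powR s)); exact: measurable_enorm.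
Qed.

(** The crude bound by the volume of a cube, in which [N - 1] factors [r] are
    bounded by 1: a power [r ^ s] with [s > -1] is then integrable by summing
    over dyadic shells, in any dimension. *)
Lemma lebesgue_eball_le (r : R) : 0 <= r -> r <= 1 ->
  (lebesgue_rV R N (eball 0 r) <= (2 ^+ N * r)%:E)%E.
Proof.
move=> r0 r1; pose B (i : 'I_N) : set R := `[- r, r]%classic.
have mB i : measurable (B i) by exact: measurable_itv.
apply: (@le_trans _ _ (lebesgue_rV R N [set y | forall i, B i (y ord0 i)])).
  apply: le_measure; rewrite ?inE.
  - exact: measurable_eball.
  - exact: (measurable_box_rV mB).
  move=> x; rewrite /eball/= subr0 => xr i; rewrite /B/= in_itv/= -ler_norml.
  exact: le_trans (coord_le_enorm _ _) (ltW xr).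
rewrite lebesgue_rV_box//.
rewrite (_ : (\prod_(i < N) _)%E = (\prod_(i < N) (2 * r))%:E); last first.
  rewrite -prodEFin; apply: eq_bigr => i _.
  rewrite /B lebesgue_measure_itv/= lte_fin; case: ifPn => h.
    by rewrite -EFinB; congr (_%:E); ring.
  have -> : r = 0.
    by apply/eqP; rewrite eq_le r0 andbT; move: h; rewrite -leNgt; lra.
  by rewrite mulr0.
rewrite lee_fin prodr_const card_ord exprMn ler_wpM2l ?exprn_ge0//.
by move: N_gt0; case: (N) => // n _; rewrite exprS ler_piMr// exprn_ile1.
Qed.

Lemma dyadic_shell (t : R) : 0 < t -> t < 1 ->
  exists n : nat, 2^-1 ^+ n.+1 <= t < 2^-1 ^+ n.
Proof.
move=> t0 t1.
have ex : exists n : nat, 2^-1 ^+ n.+1 <= t.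
  have : (2^-1 : R) ^+ n @[n --> \oo] --> 0.
    by apply: cvg_expr; rewrite ger0_norm// invf_lt1// ltr1n.
  move=> /cvgr0_norm_lt/(_ _ t0)[n _ /(_ n.+1 (leqnSn n))/= h].
  by exists n; rewrite ltW// (le_lt_trans _ h)// ler_norm.
case: (ex_minnP ex) => n hn nmin; exists n; rewrite hn/=.
case: n hn nmin => [|n] _ nmin; first by rewrite expr0.
by rewrite ltNge; apply/negP => /nmin; rewrite ltnn.
Qed.

Let c (n : nat) : R := (2^-1 ^+ n.+1) `^ s.

(** At a point of the [n]-th dyadic shell the [n]-th term alone suffices. *)
Lemma singular_majorant_le v : ((singular_majorant v)%:E <=
  \sum_(n <oo) (c n * \1_(eball 0 (2^-1 ^+ n)) v)%:E)%E.
Proof.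
have pos n : (0 <= (c n * \1_(eball 0 (2^-1 ^+ n)) v)%:E)%E.
  by rewrite lee_fin mulr_ge0 ?powR_ge0// indicE; case: (_ \in _).
rewrite /singular_majorant; case: ifP => v1; last exact: nneseries_ge0.
have [v0|v0] := eqVneq v 0.
  by rewrite {1}v0 enorm0 powR0 ?lt_eqF//; exact: nneseries_ge0.
have [n /andP[nv vn]] := dyadic_shell (enorm_gt0 v0) v1.
apply: le_trans (nneseries_lim_ge n.+1 (fun n _ _ => pos n)).
rewrite big_nat_recr//=; apply: le_trans (leeDr _ _); last exact: sume_ge0.
rewrite lee_fin indicE mem_set ?mulr1; last first.
  by rewrite /eball/= subr0.
rewrite /c -(opprK s) !(powRN _ (- s)) lef_pV2 ?posrE ?powR_gt0 ?exprn_gt0 ?enorm_gt0//.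
by apply: ge0_ler_powR; rewrite ?nnegrE ?enorm_ge0 ?exprn_ge0// oppr_ge0 ltW.
Qed.

(** The sum over the dyadic balls is bounded by a geometric series of ratio
    2^(- s - 1). *)
Lemma integral_singular_majorant_lty :
  (\int[lebesgue_rV R N]_v (singular_majorant v)%:E < +oo)%E.
Proof.
apply: (@le_lt_trans _ _ (\int[lebesgue_rV R N]_v
    \sum_(n <oo) (c n * \1_(eball 0 (2^-1 ^+ n)) v)%:E)%E).
  apply: ge0_le_integral => //.
  - by move=> v _; rewrite lee_fin singular_majorant_ge0.
  - apply/measurable_EFinP; exact: measurable_singular_majorant.
  - apply: ge0_emeasurable_sum => n.
      by move=> v _ _; rewrite lee_fin mulr_ge0 ?powR_ge0// indicE; case: (_ \in _).
    move=> _; apply/measurable_EFinP; apply: measurable_funM => //.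
    exact: measurable_indic (measurable_eball _ _).
  - by move=> v _; exact: singular_majorant_le.
rewrite integral_nneseries//; last 2 first.
- move=> n; apply/measurable_EFinP; apply: measurable_funM => //.
  exact: measurable_indic (measurable_eball _ _).
- by move=> n v _; rewrite lee_fin mulr_ge0 ?powR_ge0// indicE; case: (_ \in _).
pose q : R := 2^-1; pose z := q `^ s * q; pose a := q `^ s * 2 ^+ N.
have q0 : 0 < q by rewrite invr_gt0.
have z1 : `|z| < 1.
  rewrite ger0_norm ?mulr_ge0 ?powR_ge0 ?ltW// /z -{2}(powRr1 (ltW q0)).
  rewrite -powRD; last by rewrite (lt0r_neq0 q0) implybT.
  have s1 : 0 < s + 1 by rewrite -ltrBlDr sub0r.
  have q1 : q < 1 by rewrite invf_lt1// ltr1n.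
  have := gt0_ltr_powR s1 (ltW q0 : q \in Num.nneg) (ler01 : 1 \in Num.nneg) q1.
  by rewrite powR1.
have le_geo n : (\int[lebesgue_rV R N]_v (c n * \1_(eball 0 (2^-1 ^+ n)) v)%:E
    <= (a * z ^+ n)%:E)%E.
  under eq_integral do rewrite EFinM.
  rewrite ge0_integralZl//; last 2 first.
  - apply/measurable_EFinP; exact: measurable_indic (measurable_eball _ _).
  - by rewrite lee_fin powR_ge0.
  rewrite integral_indic//; last exact: measurable_eball.
  rewrite setIT.
  have h : (lebesgue_rV R N (eball 0 (2^-1 ^+ n)) <= (2 ^+ N * 2^-1 ^+ n)%:E)%E.
    apply: lebesgue_eball_le; first by rewrite exprn_ge0.
    by rewrite exprn_ile1// invf_le1// ler1n.
  apply: le_trans (lee_wpmul2l _ h) _; first by rewrite lee_fin powR_ge0.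
  rewrite -EFinM lee_fin /c /a /z exprMn -/q.
  have -> : (q ^+ n.+1) `^ s = (q `^ s) ^+ n.+1.
    rewrite -(powR_mulrn n.+1 (ltW q0)) -powRrM mulrC powRrM powR_mulrn//.
    exact: powR_ge0.
  by rewrite exprS le_eqVlt; apply/orP; left; apply/eqP; ring.
apply: (@le_lt_trans _ _ (\sum_(n <oo) (a * z ^+ n)%:E)%E).
  apply: lee_nneseries => // n _ _; apply: integral_ge0 => v _.
  by rewrite lee_fin mulr_ge0 ?powR_ge0// indicE; case: (_ \in _).
have h := cvg_geometric_series (a := a) z1.
rewrite (_ : (\sum_(n <oo) (a * z ^+ n)%:E)%E = (a / (1 - z))%:E) ?ltry//.
apply/cvg_lim => //; apply: cvg_EFin; first by near=> n; rewrite sumEFin.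
rewrite (_ : _ \o _ = series (geometric a z)) //.
apply/funext => n /=; rewrite sumEFin //.
Unshelve. all: by end_near. Qed.

End singular_integrable.

(** * An antisymmetry argument *)

Section enorm_topology.
Variables (R : realType) (N : nat).
Implicit Types (A : set 'rV[R]_N) (x y : 'rV[R]_N).

Lemma open_enorm A x : open A -> A x ->
  exists2 d : R, 0 < d & forall y, enorm (y - x) < d -> A y.
Proof.
move=> oA /(open_rV_box oA)[d d0 dA]; exists d => // y yx; apply: dA => i.
by apply: le_lt_trans yx; have := coord_le_enorm (y - x) i; rewrite !mxE.
Qed.

Lemma closure_enorm A x :
  closure A x <-> forall d : R, 0 < d -> exists2 y, A y & enorm (y - x) < d.
Proof.
split=> [Ax d d0|Ax B].
  have [|y [Ay]] := Ax (eball x d); last by exists y.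
  apply: open_nbhs_nbhs; split; first exact: open_eball.
  by rewrite /eball/= subrr enorm0.
rewrite nbhsE => -[U [oU Ux] UB].
have [d d0 dU] := open_enorm oU Ux.
have [y Ay /dU Uy] := Ax d d0.
by exists y; split => //; exact: UB.
Qed.

End enorm_topology.

Section antisymmetric.
Variables (R : realType) (N : nat) (e : 'rV[R]_N) (l : R).
Hypothesis e1 : dot e e = 1.
Variable Omega : set 'rV[R]_N.
Hypothesis oOmega : open Omega.
Let sigma := reflection e l.
Let lam := lebesgue_rV R N.

Hypothesis cap : forall x, Omega x -> l < dot x e -> Omega (sigma x).

(** On the part S of [Omega] whose mirror image is in [Omega] the kernel
    integrates to 0, since S is its own mirror image. By [cap] the rest of
    [Omega] is below the mirror, where the kernel is positive; its integral
    being at most 0, this rest is a null set. *)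
Lemma antisymmetric_null (K : 'rV[R]_N -> R) :
  measurable_fun setT K ->
  lam.-integrable Omega (EFin \o K) ->
  (forall y, K (sigma y) = - K y) ->
  (forall y, Omega y -> dot y e < l -> 0 < K y) ->
  (\int[lam]_(y in Omega) (K y)%:E <= 0)%E ->
  lam (Omega `\` sigma @^-1` Omega) = 0%E.
Proof.
move=> mK iK Kanti Kpos K_le0.
have mO := measurable_open_rV oOmega.
have mp : measure_preserving lam sigma by exact: lebesgue_reflection.
have mO' : measurable (sigma @^-1` Omega).
  by apply: measurable_preimage mO; exact: mp.1.
pose S := Omega `&` sigma @^-1` Omega; pose D := Omega `\` sigma @^-1` Omega.
have mS : measurable S by exact: measurableI.
have mD : measurable D by exact: measurableD.
have mKE : measurable_fun setT (EFin \o K) by exact/measurable_EFinP.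
have SD : Omega = S `|` D by rewrite /S /D setUIDK.
have iS : lam.-integrable S (EFin \o K).
  by apply: integrableS iK => // x [].
have iD : lam.-integrable D (EFin \o K).
  by apply: integrableS iK => // x [].
have sS : sigma @^-1` S = S.
  apply/seteqP; split=> x; rewrite /S/= /sigma reflectionK// => -[].
    by [].
  by [].
have S0 : (\int[lam]_(y in S) (K y)%:E = 0)%E.
  have E : (EFin \o K) \o sigma = (fun y => - (K y)%:E)%E.
    by apply/funext => y /=; rewrite Kanti.
  have iSs : lam.-integrable (sigma @^-1` S) ((EFin \o K) \o sigma).
    by rewrite sS E; exact: integrableN.
  have := integral_preserving mp mS mKE iSs; rewrite sS.
  under eq_integral do rewrite /= Kanti EFinN -mulN1e.
  rewrite integralZl//.
  have /fineK <- : (\int[lam]_(y in S) (K y)%:E)%E \is a fin_num.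
    exact: integrable_fin_num.
  by rewrite -EFinM mulN1r => -[] h; congr (_%:E); lra.
(* a point on the mirror is its own image, so that it is not in D *)
have Dpos y : D y -> 0 < K y.
  move=> [Oy nOy]; apply: Kpos => //; rewrite ltNge le_eqVlt.
  apply/negP => /orP[/eqP ly|]; last by move=> /(cap Oy).
  by apply: nOy; rewrite /= /sigma /reflection -ly subrr mulr0 scale0r subr0.
have D0 : (\int[lam]_(y in D) `|(K y)%:E| = 0)%E.
  have -> : (\int[lam]_(y in D) `|(K y)%:E| = \int[lam]_(y in D) (K y)%:E)%E.
    by apply: eq_integral => y /[!inE] /Dpos Ky; rewrite gee0_abs// lee_fin ltW.
  apply/eqP; rewrite eq_le; apply/andP; split.
    move: K_le0; rewrite {1}SD integral_setU//=; first by rewrite S0 add0e.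
      by rewrite -SD; exact: measurable_funTS.
    by apply/disj_setPS => x [[_ ?] []].
  by apply: integral_ge0 => y /Dpos Ky; rewrite lee_fin ltW.
have mKD : measurable_fun D (EFin \o K) by exact: measurable_funTS.
have [/(_ D0) + _] := ae_eq_integral_abs lam mD mKD.
move=> [A [mA A0 DA]].
apply/eqP; rewrite eq_le measure_ge0 andbT -A0 le_measure ?inE//.
move=> y Dy; apply: DA => /= /(_ Dy)[].
by apply/eqP; rewrite gt_eqF// Dpos.
Qed.

(** If the mirror image of a point of [Omega] were missing, an exterior point
    near that image would give an open set of points of [Omega] with missing
    images, of positive measure. *)
Lemma null_symmetric :
  (forall p d, ~ Omega p -> 0 < d ->
    exists2 q, enorm (q - p) < d & ~ closure Omega q) ->
  lam (Omega `\` sigma @^-1` Omega) = 0%E -> Omega `<=` sigma @^-1` Omega.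
Proof.
move=> ext null y Oy; apply: contrapT => nOy.
have [d d0 dO] := open_enorm oOmega Oy.
have [q qd nq] := ext _ _ nOy d0.
pose U := Omega `&` sigma @^-1` (~` closure Omega).
have oU : open U.
  apply: openI => //; apply: open_comp.
    by move=> x _; exact: continuous_reflection.
  by rewrite openC; exact: closed_closure.
have U0 : U !=set0.
  exists (sigma q); split; last by rewrite /= /sigma reflectionK.
  by apply: dO; rewrite /sigma enorm_reflectionl.
have := lebesgue_open_gt0 oU U0.
rewrite ltNge => /negP; apply; rewrite -null le_measure ?inE//.
- exact: measurable_open_rV.
- apply: measurableD; first exact: measurable_open_rV.
  apply: measurable_preimage; last exact: measurable_open_rV.
  exact: measurable_reflection.
- by move=> x [Ox nx]; split=> // sx; apply: nx; exact: subset_closure.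
Qed.

End antisymmetric.

(** * Boundary points on lines, exterior points *)

Section boundary_geometry.
Variables (R : realType) (N : nat).
Implicit Types (A : set 'rV[R]_N) (x v : 'rV[R]_N).

Lemma boundary_open A : open A -> boundary A = closure A `\` A.
Proof. by move=> oA; rewrite /boundary (iffLR (interior_id A) oA). Qed.

Lemma closed_boundary A : closed (boundary A).
Proof.
apply: closedI; first exact: closed_closure.
by rewrite -openC setCK; exact: open_interior.
Qed.

Lemma enorm_line x v (s t : R) : enorm v = 1 ->
  enorm ((x + s *: v) - (x + t *: v)) = `|s - t|.
Proof.
by move=> v1; rewrite opprD addrACA subrr add0r -scalerBl enormZ v1 mulr1.
Qed.

(** The infimum of the parameters at which the line is outside [A]. *)
Lemma line_exit A x v (t : R) : open A -> enorm v = 1 -> A x -> 0 <= t ->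
  ~ A (x + t *: v) -> exists s, 0 < s <= t /\ boundary A (x + s *: v).
Proof.
move=> oA v1 Ax t0 At.
pose E := [set s : R | 0 <= s /\ ~ A (x + s *: v)].
have Et : E t by [].
have Elb : lbound E 0 by move=> s [].
have Einf : has_inf E by split; [exists t|exists 0].
pose s := inf E.
have s0 : 0 <= s by apply: lb_le_inf => //; exists t.
have st : s <= t by apply: ge_inf => //; exists 0.
have in_lt r : 0 <= r -> r < s -> A (x + r *: v).
  move=> r0 rs; apply: contrapT => nA.
  by move: rs; rewrite ltNge => /negP; apply; apply: ge_inf => //; exists 0.
have sA : ~ A (x + s *: v).
  move=> As; have [d d0 dA] := open_enorm oA As.
  have [r [r0 nAr] rs] := inf_adherent d0 Einf.
  have sr : s <= r by apply: ge_inf => //; exists 0.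
  apply: nAr; apply: dA; rewrite enorm_line// ger0_norm ?subr_ge0//.
  by rewrite ltrBlDl.
have sgt0 : 0 < s.
  rewrite lt_def s0 andbT; apply/eqP => sE; apply: sA.
  by rewrite sE scale0r addr0.
exists s; rewrite sgt0 st boundary_open//; split=> //; split=> //.
apply/closure_enorm => d d0.
exists (x + Num.max 0 (s - d / 2) *: v).
  by apply: in_lt; rewrite ?le_max ?lexx// gt_max sgt0/= ltrBlDr ltrDl divr_gt0.
rewrite enorm_line// /Num.max; case: ifP => h.
  by rewrite ltr_norml; lra.
by rewrite ltr_norml; lra.
Qed.

Lemma bounded_enorm A : bounded_set A -> exists M, forall x, A x -> enorm x <= M.
Proof.
move=> [M [_ MA]]; exists (N%:R * (M + 1)) => x Ax.
apply: le_trans (enorm_le_norm x) _; rewrite ler_wpM2l//.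
by apply: MA => //; rewrite ltrDl.
Qed.

Lemma bounded_line_exit A x v : open A -> bounded_set A -> enorm v = 1 -> A x ->
  exists s, 0 < s /\ boundary A (x + s *: v).
Proof.
move=> oA /bounded_enorm[M MA] v1 Ax.
pose t := M + 1 + enorm x.
have M0 : 0 <= M by apply: le_trans (MA _ Ax); exact: enorm_ge0.
have t0 : 0 <= t by rewrite !addr_ge0 ?enorm_ge0.
have [|s [/andP[s0 _] bs]] := line_exit oA v1 Ax t0.
  move=> /MA; apply/negP; rewrite -ltNge.
  have := enormD (x + t *: v) (- x).
  rewrite addrC addKr enormZ v1 mulr1 ger0_norm// enormN /t; lra.
by exists s.
Qed.

(** Near a boundary point the set is the strict epigraph of a continuous
    function; moving down along the axis of the graph, by however little, leads
    strictly below the graph and hence out of the closure. *)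
Lemma C1_boundary_exterior A p (d : R) : open A -> C1_boundary A -> ~ A p -> 0 < d ->
  exists2 q, enorm (q - p) < d & ~ closure A q.
Proof.
move=> oA C1A nAp d0.
have [cAp|ncAp] := pselect (closure A p); last first.
  by exists p => //; rewrite subrr enorm0.
have [|r [k [b [g [r0 [dg _] Aloc]]]]] := C1A p; first by rewrite boundary_open.
pose F x := (-1) ^+ b * x ord0 k - g (col' k x).
have c1 : continuous (fun x : 'rV[R]_N => (-1) ^+ b * x ord0 k : R).
  apply: (@continuous_of_enorm_lipschitz _ _ 1) => x y; rewrite mul1r -mulrBr.
  rewrite normrM normrX normrN1 expr1n mul1r.
  by have := coord_le_enorm (x - y) k; rewrite !mxE.
have c2 : continuous (fun x : 'rV[R]_N => g (col' k x)).
  move=> x; apply: (@continuous_comp _ _ _ (col' k) g).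
    2: exact: differentiable_continuous.
  move=> B /nbhs_ballP[c /= c0 cB]; apply/nbhs_ballP; exists c => //= y xy.
  apply: cB; move: xy; rewrite /ball/= /mx_ball => -[_ xy]; split=> // i j.
  by rewrite !mxE; exact: xy.
have cF : continuous F by move=> x; exact: (continuousB (c1 x) (c2 x)).
have locE x : enorm (x - p) < r -> A x <-> 0 < F x.
  move=> xr; rewrite /F subr_gt0.
  have : (A `&` eball p r) x <->
      ([set x | g (col' k x) < (-1) ^+ b * x ord0 k] `&` eball p r) x.
    by rewrite Aloc.
  by rewrite /setI/= /eball/=; tauto.
pose m := Num.min d r / 2.
have m0 : 0 < m by rewrite divr_gt0// lt_min d0 r0.
have md : m < d.
  by rewrite ltr_pdivrMr// (@le_lt_trans _ _ d) ?ge_min ?lexx//; lra.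
have mr : m < r.
  by rewrite ltr_pdivrMr// (@le_lt_trans _ _ r) ?ge_min ?lexx ?orbT//; lra.
pose q := p - (m * (-1) ^+ b) *: delta_mx ord0 k.
have qp : enorm (q - p) = m.
  rewrite /q addrC addKr enormN enormZ normrM normrX normrN1 expr1n mulr1.
  rewrite gtr0_norm// enormE (_ : dot _ _ = 1) ?sqrtr1 ?mulr1//.
  rewrite /dot (bigD1 k)//= !mxE !eqxx mulr1 big1 ?addr0// => i ik.
  by rewrite !mxE (negbTE ik) andbF mulr0.
have Fq : F q = F p - m.
  rewrite /F (_ : col' k q = col' k p); last first.
    by apply/rowP => j; rewrite !mxE [lift k j == k]eq_sym (negbTE (neq_lift _ _)) andbF mulr0 subr0.
  by rewrite /q !mxE !eqxx mulr1 mulrBr mulrCA -expr2 sqrr_sign mulr1 addrAC.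
have Fp : F p <= 0.
  rewrite leNgt; apply/negP => Fp; apply: nAp; apply/locE => //.
  by rewrite subrr enorm0.
exists q => [|cq]; first by rewrite qp.
pose V := eball p r `&` F @^-1` [set y | y < 0].
have oV : open V.
  apply: openI; first exact: open_eball.
  by apply: open_comp => // x _; exact: cF.
have Vq : V q by split; rewrite /eball/= ?qp// Fq; lra.
have [y [Ay [Vy Fy]]] := cq V (open_nbhs_nbhs (conj oV Vq)).
by move: Ay Fy => /locE -/(_ Vy)/= h1 h2; have := lt_trans h1 h2; rewrite ltxx.
Qed.

End boundary_geometry.

(** * Chords and the critical position of the mirror *)

Section critical_position.
Variables (R : realType) (N : nat) (Omega : set 'rV[R]_N) (e : 'rV[R]_N).
Hypotheses (oOmega : open Omega) (bOmega : bounded_set Omega).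
Hypothesis e1 : dot e e = 1.

Let enorm_e : enorm e = 1. Proof. by rewrite enormE e1 sqrtr1. Qed.
Let enormN_e : enorm (- e) = 1. Proof. by rewrite enormN. Qed.

Definition chord (w : 'rV[R]_N) (t : R) :=
  [/\ 0 < t, boundary Omega w & boundary Omega (w - t *: e)].

Lemma chord_end x (s s' : R) :
  x + s *: e - (s + s') *: e = x + s' *: - e.
Proof. by rewrite scalerDl scalerN opprD addrA addrK. Qed.

Lemma chord_through x : Omega x -> exists s s' : R,
  [/\ 0 < s, 0 < s' & chord (x + s *: e) (s + s')].
Proof.
move=> Ox.
have [s [s0 bs]] := bounded_line_exit oOmega bOmega enorm_e Ox.
have [s' [s'0 bs']] := bounded_line_exit oOmega bOmega enormN_e Ox.
exists s, s'; split; [exact: s0|exact: s'0|split].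
- exact: addr_gt0.
- exact: bs.
- by rewrite chord_end; exact: bs'.
Qed.

Lemma boundary_bounded : exists2 M : R, 0 <= M &
  forall x, boundary Omega x -> enorm x <= M.
Proof.
have [M MO] := bounded_enorm bOmega.
exists (`|M| + 1) => [|x]; first by rewrite addr_ge0.
rewrite boundary_open// => -[/closure_enorm/(_ _ ltr01)[y Oy yx] _].
rewrite -[x](subrK y) (le_trans (enormD _ _))// addrC lerD//.
  by rewrite (le_trans (MO _ Oy))// ler_norm.
by rewrite enormB ltW.
Qed.

Lemma compact_boundary : compact (boundary Omega).
Proof.
apply: bounded_closed_compact; last exact: closed_boundary.
have [M M0 MO] := boundary_bounded.
exists M; split; first exact: num_real.
move=> K MK x /MO xM; apply: le_trans (norm_le_enorm x) _.
exact: le_trans xM (ltW MK).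
Qed.

(** The chords, seen as pairs of an end and a length, form a set with compact
    closure, on which the height of the midpoint attains its maximum. Lengths
    may shrink to 0 in the limit, whence the sequence of chords in the
    conclusion. *)
Lemma critical_position : Omega !=set0 ->
  exists (l : R) (w : 'rV[R]_N) (t : R) (w_ : nat -> 'rV[R]_N) (t_ : nat -> R),
  [/\ forall w' t', chord w' t' -> dot w' e - t' / 2 <= l,
      dot w e - t / 2 = l,
      [/\ 0 <= t, boundary Omega w & boundary Omega (w - t *: e)],
      forall n, chord (w_ n) (t_ n) &
      w_ n @[n --> \oo] --> w /\ t_ n @[n --> \oo] --> t].
Proof.
move=> [x0 Ox0].
pose S := [set p : 'rV[R]_N * R | chord p.1 p.2].
have [M M0 MO] := boundary_bounded.
pose B := boundary Omega `*` `[0, 2 * M]%classic.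
have cB : compact B.
  by apply: compact_setX; [exact: compact_boundary|exact: segment_compact].
have SB : S `<=` B.
  move=> [w t] [/= t0 bw bz]; split=> //=; rewrite in_itv/= ltW//=.
  have := enorm_line w 0 (- t) enorm_e.
  rewrite scale0r addr0 scaleNr sub0r opprK gtr0_norm// => <-.
  by rewrite (le_trans (enormD _ _))// enormN mulr_natl lerD// MO.
have clB : closed B by apply: compact_closed => //; exact: norm_hausdorff.
have CB : closure S `<=` B.
  by move=> p /(closureS SB); rewrite -(iffLR (closure_id B) clB).
have cS : compact (closure S).
  by apply: subclosed_compact CB => //; exact: closed_closure.
have S0 : closure S !=set0.
  have [s [s' [_ _ ch]]] := chord_through Ox0.
  by exists (x0 + s *: e, s + s'); apply: subset_closure.
pose f (p : 'rV[R]_N * R) : R := dot p.1 e - p.2 / 2.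
have cf : continuous f.
  move=> p; apply: cvgB.
    apply: (@continuous_comp _ _ _ fst (fun x => dot x e)); first exact: cvg_fst.
    exact: continuous_dotl.
  by apply: cvgMr_tmp; exact: cvg_snd.
have [[w t] /[!inE] Cwt max] := compact_EVT_max S0 cS (continuous_subspaceT cf).
have /choice[p_ pP] : forall n : nat, exists p, S p /\ ball (w, t) n.+1%:R^-1 p.
  move=> n; have n0 : 0 < n.+1%:R^-1 :> R by rewrite invr_gt0.
  by have [p [Sp Bp]] := Cwt _ (nbhsx_ballx (w, t) _ n0); exists p.
have wcvg : (p_ n).1 @[n --> \oo] --> w.
  apply/cvgrPdist_lt => d d0; near=> n.
  have [_ [+ _]] := pP n; rewrite -ball_normE/= => h.
  by apply: lt_trans h _; near: n; exact: near_infty_natSinv_lt (PosNum d0).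
have tcvg : (p_ n).2 @[n --> \oo] --> t.
  apply/cvgrPdist_lt => d d0; near=> n.
  have [_ [_ +]] := pP n; rewrite -ball_normE/= => h.
  by apply: lt_trans h _; near: n; exact: near_infty_natSinv_lt (PosNum d0).
exists (f (w, t)), w, t, (fun n => (p_ n).1), (fun n => (p_ n).2).
have [/= bw] := CB _ Cwt; rewrite in_itv/= => /andP[t0 _].
split => //.
- move=> w' t' ch; apply: (max (w', t')); rewrite inE; exact: subset_closure.
- split => //.
  apply: (@closed_cvg _ _ \oo _ (fun n => (p_ n).1 - (p_ n).2 *: e) _
    (closed_boundary (A := Omega))).
    by apply: nearW => n; have [[]] := pP n.
  apply: cvgB => //; apply: cvgZr_tmp => //.
- by move=> n; have [] := pP n.
Unshelve. all: by end_near. Qed.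

(** If the mirror image of [x] were missing, the line through [x] along [e]
    would leave [Omega] below [x] at a distance at most that of the image, and
    above [x] at a positive distance: a chord with its midpoint above [l']. *)
Lemma cap_reflection (l l' : R) x :
  (forall w' t', chord w' t' -> dot w' e - t' / 2 <= l) -> l <= l' ->
  Omega x -> l' < dot x e -> Omega (reflection e l' x).
Proof.
move=> lmax ll' Ox lx; apply: contrapT => nO.
have t0 : 0 <= 2 * (dot x e - l') by lra.
have [|s [/andP[s0 st] bs]] := line_exit oOmega enormN_e Ox t0.
  by rewrite scalerN.
have [s' [s'0 bs']] := bounded_line_exit oOmega bOmega enorm_e Ox.
have ch : chord (x + s' *: e) (s' + s).
  split; [exact: addr_gt0|exact: bs'|].
  by rewrite chord_end; exact: bs.
have := lmax _ _ ch; rewrite !dotE e1; lra.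
Qed.

End critical_position.

(** * Fatou's lemma with a varying majorant *)

Section fatou_varying_majorant.
Context d (T : measurableType d) (R : realType).
Variables (mu : {measure set T -> \bar R}) (D : set T) (mD : measurable D).
Variables (G_ q_ : nat -> T -> R) (G q : T -> R) (I : R).
Hypotheses (mG_ : forall n, measurable_fun setT (G_ n)).
Hypotheses (mG : measurable_fun setT G).
Hypotheses (mq_ : forall n, measurable_fun setT (q_ n)).
Hypotheses (mq : measurable_fun setT q).
Hypotheses (G_ge0_ : forall n y, 0 <= G_ n y) (G_ge0 : forall y, 0 <= G y).
Hypotheses (intG_ : forall n, (\int[mu]_y (G_ n y)%:E = I%:E)%E).
Hypotheses (intG : (\int[mu]_y (G y)%:E = I%:E)%E).
Hypotheses (qG_ : forall n y, D y -> `|q_ n y| <= G_ n y).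
Hypotheses (qG : forall y, D y -> `|q y| <= G y).
Hypotheses (cvgG : forall y, ((G y)%:E <= limn_einf (fun n => (G_ n y)%:E))%E).
Hypotheses (cvgG_in : forall y, D y -> G_ n y @[n --> \oo] --> G y).
Hypotheses (cvgq : forall y, D y -> q_ n y @[n --> \oo] --> q y).
Hypotheses (intq_ : forall n, (\int[mu]_(y in D) (q_ n y)%:E <= 0)%E).

Let integrable_of (f : T -> R) : measurable_fun setT f -> (forall y, 0 <= f y) ->
  (\int[mu]_y (f y)%:E = I%:E)%E -> mu.-integrable setT (EFin \o f).
Proof.
move=> mf f0 fI; apply/integrableP; split; first exact/measurable_EFinP.
rewrite (eq_integral (fun y => (f y)%:E)) ?fI ?ltry// => y _ /=.
by rewrite ger0_norm.
Qed.

Let integrable_dom (f g : T -> R) : measurable_fun setT f -> measurable_fun setT g ->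
  (forall y, 0 <= g y) -> (\int[mu]_y (g y)%:E = I%:E)%E ->
  (forall y, D y -> `|f y| <= g y) -> mu.-integrable D (EFin \o f).
Proof.
move=> mf mg g0 gI fg.
have : mu.-integrable D (EFin \o g).
  by apply: integrableS (integrable_of mg g0 gI).
apply: le_integrable => //; first by apply/measurable_EFinP; exact: measurable_funTS.
by move=> y Dy /=; rewrite lee_fin (le_trans (fg _ Dy))// ler_norm.
Qed.

Let integral_sum (f g : T -> R) : measurable_fun setT f -> measurable_fun setT g ->
  (forall y, 0 <= g y) -> (\int[mu]_y (g y)%:E = I%:E)%E ->
  (forall y, D y -> `|f y| <= g y) ->
  (\int[mu]_y ((g y)%:E + ((EFin \o f) \_ D) y) =
   I%:E + \int[mu]_(y in D) (f y)%:E)%E.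
Proof.
move=> mf mg g0 gI fg; rewrite integralD//.
- by rewrite gI -integral_mkcond.
- exact: integrable_of.
- by apply: (integrable_mkcond _ mD).1; exact: (integrable_dom mf mg).
Qed.

(** Fatou's lemma applied to [G_ n + q_ n], where [q_ n] is extended by 0 outside
    [D]. The majorants vary but have constant integral, which cancels. Outside
    [D] lower semicontinuity of the majorants is enough. *)
Lemma fatou_varying_majorant : (\int[mu]_(y in D) (q y)%:E <= 0)%E.
Proof.
pose F_ n y := ((G_ n y)%:E + ((EFin \o q_ n) \_ D) y)%E.
pose F y := ((G y)%:E + ((EFin \o q) \_ D) y)%E.
have F0 (f g : T -> R) : (forall y, 0 <= g y) -> (forall y, D y -> `|f y| <= g y) ->
    forall y, (0 <= (g y)%:E + ((EFin \o f) \_ D) y)%E.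
  move=> g0 fg y; rewrite patchE; case: ifPn => [/set_mem Dy|_] /=.
    by rewrite -EFinD lee_fin; have := fg _ Dy; rewrite ler_norml => /andP[]; lra.
  by rewrite adde0 lee_fin.
have mF (f g : T -> R) : measurable_fun setT f -> measurable_fun setT g ->
    measurable_fun setT (fun y => (g y)%:E + ((EFin \o f) \_ D) y)%E.
  move=> mf mg; apply: emeasurable_funD; first exact/measurable_EFinP.
  apply: (measurable_restrictT _ mD).1; apply: measurable_funTS.
  exact/measurable_EFinP.
have le_F y : (F y <= limn_einf (F_ ^~ y))%E.
  rewrite /F /F_ patchE; case: ifPn => [/[dup] yD /set_mem Dy|nD].
    have cF : ((G_ n y)%:E + ((EFin \o q_ n) \_ D) y)%E @[n --> \oo] -->
        ((G y)%:E + (q y)%:E)%E.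
      rewrite -EFinD; under eq_fun do rewrite patchE yD /= -EFinD.
      by apply: cvg_EFin; [exact: nearW|apply: cvgD; [exact: cvgG_in|exact: cvgq]].
    by rewrite (cvg_limn_einf_sup cF).1.
  rewrite adde0.
  under [X in (_ <= limn_einf X)%E]eq_fun do rewrite patchE (negbTE nD) adde0.
  exact: cvgG.
have : (\int[mu]_y F y <= I%:E)%E.
  apply: le_trans (_ : \int[mu]_y limn_einf (F_ ^~ y) <= _)%E.
    apply: ge0_le_integral => //.
    - by move=> y _; apply: F0.
    - exact: mF.
    - rewrite /limn_einf; apply: measurableT_comp => //.
      apply: measurable_fun_limn_esup => n; apply: measurableT_comp => //.
      exact: mF.
  apply: le_trans (fatou _ _ _ _) _ => //.
  - by move=> n; exact: mF.
  - by move=> n y _; apply: F0 => // z; exact: qG_.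
  rewrite limn_einf_lim; apply: lime_le; first exact: is_cvg_einfs.
  apply: nearW => n; apply: (@le_trans _ _ (\int[mu]_y F_ n y)%E).
    by apply: ereal_inf_lbound; exists n => /=.
  rewrite /F_ (integral_sum (mq_ n) (mG_ n) (G_ge0_ n) (intG_ n) (@qG_ n)).
  by rewrite -[X in (_ <= X)%E]adde0 leeD2l.
rewrite /F (integral_sum mq mG G_ge0 intG qG).
have /fineK <- : (\int[mu]_(y in D) (q y)%:E)%E \is a fin_num.
  exact: integrable_fin_num (integrable_dom mq mG G_ge0 intG qG).
by rewrite -EFinD !lee_fin; lra.
Qed.

End fatou_varying_majorant.

(** * Difference quotients over shrinking chords *)

Section quotient_limit.
Variables (R : realType) (N : nat) (b : R).
Hypothesis b_gt0 : 0 < b.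

(** Mean value theorem for radii in either order; the intermediate point is
    located by a bound that suits limits. *)
Lemma profile_MVT_between (r s : R) : 0 < s -> 0 < r ->
  exists x : R, (forall c, `|x - c| <= `|r - c| + `|s - c|) /\
    profile b r - profile b s = dprofile b x * (r - s).
Proof.
wlog sr : s r / s <= r.
  move=> H s0 r0; have [/H|/ltW/H] := leP s r; first exact.
  move=> /(_ r0 s0)[x [xc h]]; exists x; split=> [c|]; first by rewrite [leRHS]addrC; exact: xc.
  by rewrite -opprB h -mulrN opprB.
move=> s0 r0; have [x /andP[sx xr] h] := profile_MVT b s0 sr.
exists x; split=> // c; have := ler_norm (r - c); have := ler_norm (c - s).
have := normr_ge0 (r - c); have := normr_ge0 (s - c).
by rewrite (distrC c) ler_norml => *; apply/andP; split; lra.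
Qed.

(** The derivative at [w], in the direction [e], of [profile b (enorm (w - y))]. *)
Definition dkernel (w e y : 'rV[R]_N) : R :=
  dprofile b (enorm (w - y)) * (dot (w - y) e / enorm (w - y)).

Variables (w e y : 'rV[R]_N) (w_ : nat -> 'rV[R]_N) (t_ : nat -> R).
Let z_ n := w_ n - t_ n *: e.
Hypotheses (e1 : dot e e = 1) (t_gt0 : forall n, 0 < t_ n).
Hypotheses (cvgw : w_ n @[n --> \oo] --> w) (cvgt : t_ n @[n --> \oo] --> 0).

Lemma cvg_chord_end : z_ n @[n --> \oo] --> w.
Proof.
rewrite -[X in _ --> X](subr0 w) -(scale0r e); apply: cvgB => //.
exact: cvgZr_tmp.
Qed.

Lemma cvg_enorm_dist (x_ : nat -> 'rV[R]_N) (x : 'rV[R]_N) :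
  x_ n @[n --> \oo] --> x -> enorm (x_ n - y) @[n --> \oo] --> enorm (x - y).
Proof.
move=> xx.
exact: (@continuous_cvg _ _ _ _ _ x_ (fun z => enorm (z - y)) x
  (@continuous_dist R N y x) xx).
Qed.

Hypotheses (wy : w != y) (w_y : forall n, w_ n != y) (z_y : forall n, z_ n != y).

(** The increment of the profile is its derivative at an intermediate radius
    times r - s, and r - s = (r^2 - s^2) / (r + s) is t times a continuous
    expression in the two ends of the chord. *)
Lemma cvg_quotient :
  (profile b (enorm (w_ n - y)) - profile b (enorm (z_ n - y))) / t_ n
    @[n --> \oo] --> dkernel w e y.
Proof.
pose r_ n := enorm (w_ n - y); pose s_ n := enorm (z_ n - y).
pose r := enorm (w - y).
have r0 : 0 < r by rewrite enorm_gt0// subr_eq0.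
have r_0 n : 0 < r_ n by rewrite enorm_gt0// subr_eq0.
have s_0 n : 0 < s_ n by rewrite enorm_gt0// subr_eq0.
have cr : r_ n @[n --> \oo] --> r by exact: cvg_enorm_dist.
have cs : s_ n @[n --> \oo] --> r by apply: cvg_enorm_dist; exact: cvg_chord_end.
have /choice[x_ xP] := fun n => profile_MVT_between (s_0 n) (r_0 n).
have cx : x_ n @[n --> \oo] --> r.
  apply/subr_cvg0; apply/norm_cvg0P.
  apply: (@squeeze_cvgr _ _ _ _ (cst 0) (fun n => `|r_ n - r| + `|s_ n - r|)).
  - by apply: nearW => n; rewrite normr_ge0 (xP n).1.
  - exact: cvg_cst.
  - rewrite -[X in _ --> X](addr0 0); apply: cvgD.
      by apply/norm_cvg0P/subr_cvg0.
    by apply/norm_cvg0P/subr_cvg0.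
pose c_ n := dot ((w_ n - y) + (z_ n - y)) e / (r_ n + s_ n).
have cc : c_ n @[n --> \oo] --> dot (w - y) e / r.
  rewrite (_ : _ / r = dot ((w - y) + (w - y)) e / (r + r)); last first.
    rewrite (dotDl (w - y)); move: (dot _ e) (lt0r_neq0 r0) => a; clearbody r.
    by move=> rn0; field; rewrite -mulr2n mulrn_eq0 /= rn0.
  apply: cvgM.
    have cd : (w_ n - y) + (z_ n - y) @[n --> \oo] --> (w - y) + (w - y).
      by apply: cvgD; apply: cvgB (cvg_cst _) => //; exact: cvg_chord_end.
    exact: (@continuous_cvg _ _ _ _ _ _ (fun z => dot z e) _
      (@continuous_dotl R N e _) cd).
  by apply: cvgV; [rewrite lt0r_neq0// addr_gt0|exact: cvgD].
have E n : (profile b (r_ n) - profile b (s_ n)) / t_ n = dprofile b (x_ n) * c_ n.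
  rewrite (xP n).2 -mulrA; congr (_ * _).
  have rs0 : r_ n + s_ n != 0 by rewrite lt0r_neq0// addr_gt0.
  have t0 : t_ n != 0 by rewrite lt0r_neq0.
  apply: (mulIf rs0); rewrite divfK//; apply: (mulIf t0); rewrite mulrAC divfK//.
  rewrite -subr_sqr !sqr_enorm.
  rewrite (_ : z_ n - y = (w_ n - y) - t_ n *: e); last by rewrite /z_ addrAC.
  by move: (w_ n - y) => a; rewrite !dotE e1 (dotC e a); ring.
rewrite (_ : (fun n => _) = (fun n => dprofile b (x_ n) * c_ n)); last first.
  by apply/funext => n; exact: E.
apply: cvgM => //.
by apply: continuous_cvg cx; exact: continuous_dprofile.
Qed.

End quotient_limit.

(** * The translated majorants *)

Section majorant.
Variables (R : realType) (N : nat) (s : R).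
Hypotheses (N_gt0 : (0 < N)%N) (s_gtN1 : -1 < s) (s_lt0 : s < 0).
Let m := @singular_majorant R N s.
Let lam := lebesgue_rV R N.
Implicit Types w x y : 'rV[R]_N.

Lemma measurable_subl w : measurable_fun setT (fun y : 'rV[R]_N => w - y).
Proof.
apply: measurable_fun_rV => i; under eq_fun do rewrite !mxE.
by apply: measurable_funB => //; exact: measurable_coord_rV.
Qed.

Lemma lebesgue_subl w : measure_preserving lam (fun y => w - y).
Proof.
have := measure_preserving_comp (lebesgue_rV_translation w) (lebesgue_rV_opp R N).
by congr (measure_preserving _ _); apply/funext => y /=; rewrite addrC.
Qed.

Lemma measurable_majorant_subl w : measurable_fun setT (fun y => m (w - y)).
Proof.
apply: (@measurableT_comp _ _ _ _ _ _ m setT (fun y => w - y)).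
  exact: measurable_singular_majorant.
exact: measurable_subl.
Qed.

Lemma integral_majorant_sum w w' :
  (\int[lam]_y (2 * (m (w - y) + m (w' - y)))%:E =
   (4 * fine (\int[lam]_y (m y)%:E))%:E)%E.
Proof.
have h v : (\int[lam]_y (m (v - y))%:E = (fine (\int[lam]_y (m y)%:E))%:E)%E.
  rewrite (ge0_integral_preserving (lebesgue_subl v) (f := EFin \o m)) /=; last 2 first.
  - by apply/measurable_EFinP; exact: measurable_singular_majorant.
  - by move=> y; rewrite lee_fin singular_majorant_ge0.
  rewrite fineK// ge0_fin_numE; first exact: integral_singular_majorant_lty.
  by apply: integral_ge0 => y _; rewrite lee_fin singular_majorant_ge0.
have mm v : measurable_fun setT (fun y => (m (v - y))%:E).
  by apply/measurable_EFinP; exact: measurable_majorant_subl.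
have m0 v y : (0 <= (m (v - y))%:E)%E by rewrite lee_fin singular_majorant_ge0.
under eq_integral do rewrite EFinM.
rewrite ge0_integralZl//; last 2 first.
- by apply/measurable_EFinP; apply: measurable_funD;
    exact: measurable_majorant_subl.
- by move=> y _; rewrite EFinD adde_ge0.
under eq_integral do rewrite EFinD.
rewrite ge0_integralD//.
by rewrite !h -EFinD -EFinM; congr (_%:E); ring.
Qed.

Lemma cvg_majorant (x_ : nat -> 'rV[R]_N) x : 0 < enorm x -> enorm x < 1 ->
  x_ n @[n --> \oo] --> x -> m (x_ n) @[n --> \oo] --> m x.
Proof.
move=> x0 x1 cx.
have cn : enorm (x_ n) @[n --> \oo] --> enorm x.
  exact: (@continuous_cvg _ _ _ _ _ x_ (@enorm R N) x (@continuous_enorm R N x) cx).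
have cp : enorm (x_ n) `^ s @[n --> \oo] --> enorm x `^ s.
  have [/derivable1_diffP d _] := is_derive1_powR s x0.
  have c := differentiable_continuous d.
  exact: (@continuous_cvg _ _ _ _ _ (fun n => enorm (x_ n)) (@powR R ^~ s) _ c cn).
rewrite /m {2}/singular_majorant x1; apply: cvg_trans cp.
apply: near_eq_cvg; near=> n; rewrite /singular_majorant ifT//.
near: n; exact: (cvgr_lt _ cn).
Unshelve. all: by end_near. Qed.

(** The majorant is continuous except at 0 and on the unit sphere, where it
    vanishes: 0 to a negative power is 0. *)
Lemma majorant_liminf (w_ z_ : nat -> 'rV[R]_N) w y :
  w_ n @[n --> \oo] --> w -> z_ n @[n --> \oo] --> w ->
  ((2 * (m (w - y) + m (w - y)))%:E <=
    limn_einf (fun n => (2 * (m (w_ n - y) + m (z_ n - y)))%:E))%E.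
Proof.
move=> cw cz.
have pos v v' : 0 <= 2 * (m v + m v').
  by rewrite mulr_ge0// addr_ge0// singular_majorant_ge0.
have liminf_ge0 :
    (0 <= limn_einf (fun n => (2 * (m (w_ n - y) + m (z_ n - y)))%:E))%E.
  rewrite limn_einf_lim; apply: lime_ge; first exact: is_cvg_einfs.
  by apply: nearW => n; apply: le_ereal_inf_tmp => _ [k _ <-]; rewrite lee_fin.
have [wy|wy] := eqVneq (w - y) 0.
  rewrite (_ : m (w - y) = 0) ?addr0 ?mulr0//.
  by rewrite /m /singular_majorant wy enorm0 ltr01 powR0// lt_eqF.
have [wy1|wy1] := ltP (enorm (w - y)) 1; last first.
  rewrite (_ : m (w - y) = 0) ?addr0 ?mulr0//.
  by rewrite /m /singular_majorant ltNge wy1.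
have c (x_ : nat -> 'rV[R]_N) : x_ n @[n --> \oo] --> w ->
    m (x_ n - y) @[n --> \oo] --> m (w - y).
  move=> cx; apply: cvg_majorant => //; first exact: enorm_gt0.
  by apply: cvgB => //; exact: cvg_cst.
have cF : (2 * (m (w_ n - y) + m (z_ n - y)))%:E @[n --> \oo] -->
    (2 * (m (w - y) + m (w - y)))%:E.
  apply: cvg_EFin; first exact: nearW.
  by apply: cvgMl_tmp; apply: cvgD; exact: c.
by rewrite (cvg_limn_einf_sup cF).1.
Qed.

End majorant.

(** * A mirror of symmetry in every direction *)

Section diameter.
Variables (R : realType) (N : nat) (A : set 'rV[R]_N).
Hypothesis bA : bounded_set A.

Lemma enorm_le_diam x y : closure A x -> closure A y -> enorm (x - y) <= diam A.
Proof.
have [M MA] := bounded_enorm bA.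
have in_le p q : A p -> A q -> enorm (p - q) <= diam A.
  move=> Ap Aq; apply: sup_ubound; last by exists (p, q).
  exists (M + M) => _ [[u v] /= [Au Av] <-].
  by rewrite (le_trans (enormD _ _))// enormN lerD// MA.
move=> /closure_enorm Ax /closure_enorm Ay; apply/ler_addgt0Pr => d d0.
have d2 : 0 < d / 2 by rewrite divr_gt0.
have [p Ap px] := Ax _ d2; have [q Aq qy] := Ay _ d2.
rewrite (_ : x - y = (p - q) + ((q - y) - (p - x))); last first.
  by apply/rowP => i; rewrite !mxE; ring.
have := enormD (p - q) ((q - y) - (p - x)).
have := enormD (q - y) (- (p - x)); rewrite enormN; have := in_le _ _ Ap Aq; lra.
Qed.

End diameter.

Section mirror.
Variables (R : realType) (N : nat) (alpha : R) (Omega : set 'rV[R]_N).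
Hypotheses (N_gt0 : (0 < N)%N) (alpha_gtN : N%:R < alpha).
Hypotheses (oOmega : open Omega) (Omega0 : Omega !=set0).
Hypotheses (bOmega : bounded_set Omega) (C1_Omega : C1_boundary Omega).
Hypothesis diam_Omega : diam Omega < expR (1 / (N%:R - alpha)).
Hypothesis u_constant : exists c : R, forall x : 'rV[R]_N,
  boundary Omega x -> log_riesz_potential alpha Omega x = c.

Let b := alpha - N%:R.
Let s := majorant_exponent b - 1.
Let lam := lebesgue_rV R N.
Let D := diam Omega.

Let b_gt0 : 0 < b. Proof. by rewrite subr_gt0. Qed.
Let s_gtN1 : -1 < s.
Proof. have := majorant_exponent_gt0 b_gt0; rewrite /s; lra. Qed.
Let s_lt0 : s < 0. Proof. by rewrite subr_lt0 majorant_exponent_lt1. Qed.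
Let mOmega : measurable Omega. Proof. exact: measurable_open_rV. Qed.

Lemma diam_lt : D < expR (- b^-1).
Proof. by move: diam_Omega; rewrite div1r -opprB invrN. Qed.

Lemma dist_boundary p y : boundary Omega p -> Omega y ->
  [/\ p != y, 0 < enorm (p - y), enorm (p - y) <= D & enorm (p - y) < 1].
Proof.
rewrite boundary_open// => -[cp nOp] Oy.
have py : p != y by apply/eqP => py; apply: nOp; rewrite py.
have pyD : enorm (p - y) <= D by apply: enorm_le_diam => //; exact: subset_closure.
split=> //; first by rewrite enorm_gt0// subr_eq0.
by apply: le_lt_trans pyD _; exact: lt_expRN_1 diam_lt.
Qed.

Lemma measurable_profile_dist p :
  measurable_fun setT (fun y : 'rV[R]_N => profile b (enorm (p - y))).
Proof.
exact: (measurableT_comp (measurable_profile b) (measurable_dist p)).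
Qed.

Lemma lebesgue_Omega_lty : (lam Omega < +oo)%E.
Proof. by apply: lebesgue_bounded_lty => //; exact: bounded_enorm. Qed.

Lemma integrable_profile p : boundary Omega p ->
  lam.-integrable Omega (EFin \o (fun y : 'rV[R]_N => profile b (enorm (p - y)))).
Proof.
move=> bp; apply: measurable_bounded_integrable => //.
- exact: lebesgue_Omega_lty.
- by apply: measurable_funTS; exact: measurable_profile_dist.
exists b^-1; split; first exact: num_real.
move=> K bK y Oy /=; have [_ _ _ d1] := dist_boundary bp Oy.
rewrite ger0_norm ?profile_ge0//; apply: le_trans (ltW bK).
exact: profile_le.
Qed.

Lemma integral_profile p : boundary Omega p ->
  (\int[lam]_(y in Omega) (profile b (enorm (p - y)))%:E =
   (log_riesz_potential alpha Omega p)%:E)%E.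
Proof.
move=> bp; rewrite /log_riesz_potential /Rintegral.
rewrite (eq_integral (fun y : 'rV[R]_N => (profile b (enorm (p - y)))%:E)); last first.
  move=> y /[!inE] Oy; have [py _ _ _] := dist_boundary bp Oy.
  by rewrite /log_riesz_kernel eq_sym (negbTE py).
by rewrite fineK//; exact: integrable_fin_num (integrable_profile bp).
Qed.

Lemma integrable_profileB p q : boundary Omega p -> boundary Omega q ->
  lam.-integrable Omega (EFin \o
    (fun y : 'rV[R]_N => profile b (enorm (p - y)) - profile b (enorm (q - y)))).
Proof.
move=> bp bq.
exact: (integrableB mOmega (integrable_profile bp) (integrable_profile bq)).
Qed.

Lemma integral_profileB p q : boundary Omega p -> boundary Omega q ->
  (\int[lam]_(y in Omega)
     (profile b (enorm (p - y)) - profile b (enorm (q - y)))%:E = 0)%E.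
Proof.
move=> bp bq; under eq_integral do rewrite EFinB.
rewrite integralB_EFin//; [|exact: integrable_profile..].
rewrite !integral_profile//; have [c uc] := u_constant.
by rewrite !uc// subee.
Qed.

Variable e : 'rV[R]_N.
Hypothesis e1 : dot e e = 1.
Let enorm_e : enorm e = 1. Proof. by rewrite enormE e1 sqrtr1. Qed.

Lemma measurable_dkernel w : measurable_fun setT (dkernel b w e).
Proof.
apply: measurable_funM.
  exact: (measurableT_comp (measurable_dprofile b) (measurable_dist w)).
apply: measurable_funM.
  exact: (measurableT_comp (measurable_dot e) (measurable_subl w)).
rewrite (_ : (fun y => _) = (fun y => enorm (w - y) `^ (-1))); last first.
  by apply/funext => y; rewrite powR_inv1 ?enorm_ge0.
exact: (measurableT_comp (measurable_powR (-1)) (measurable_dist w)).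
Qed.

Lemma dkernel_le w y : boundary Omega w -> Omega y ->
  `|dkernel b w e y| <=
   2 * (singular_majorant s (w - y) + singular_majorant s (w - y)).
Proof.
move=> bw Oy; have [_ r0 rD r1] := dist_boundary bw Oy.
have dp := dprofile_gt0 b_gt0 r0 (le_lt_trans rD diam_lt).
rewrite /dkernel /singular_majorant r1 normrM gtr0_norm//.
have := dprofile_le b_gt0 r0 r1; rewrite -/s => h.
have c1 : `|dot (w - y) e / enorm (w - y)| <= 1.
  rewrite normf_div [X in _ / X]gtr0_norm// ler_pdivrMr// mul1r.
  by rewrite (le_trans (normr_dot_le _ _))// enorm_e mulr1.
apply: le_trans (ler_wpM2l (ltW dp) c1) _; rewrite mulr1.
by apply: le_trans h _; have := powR_ge0 (enorm (w - y)) s; lra.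
Qed.

(** The integrals over [Omega] of the difference quotients vanish, since the
    potential takes the same value at both ends of a chord. *)
Lemma tangential_integral_le0 w (w_ : nat -> 'rV[R]_N) (t_ : nat -> R) :
  boundary Omega w -> (forall n, chord Omega e (w_ n) (t_ n)) ->
  w_ n @[n --> \oo] --> w -> t_ n @[n --> \oo] --> 0 ->
  (\int[lam]_(y in Omega) (dkernel b w e y)%:E <= 0)%E.
Proof.
move=> bw ch cw ct.
pose z_ n := w_ n - t_ n *: e.
have t0 n : 0 < t_ n by have [] := ch n.
have bw_ n : boundary Omega (w_ n) by have [] := ch n.
have bz_ n : boundary Omega (z_ n) by have [] := ch n.
have cz : z_ n @[n --> \oo] --> w by exact: cvg_chord_end.
pose m v := @singular_majorant R N s v.
apply: (@fatou_varying_majorant _ _ _ lam Omega mOmega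
  (fun n y => 2 * (m (w_ n - y) + m (z_ n - y)))
  (fun n y => (profile b (enorm (w_ n - y)) - profile b (enorm (z_ n - y))) / t_ n)
  (fun y => 2 * (m (w - y) + m (w - y))) _
  (4 * fine (\int[lam]_y (m y)%:E))).
- move=> n; apply: measurable_funM => //.
  by apply: measurable_funD; exact: measurable_majorant_subl.
- apply: measurable_funM => //.
  by apply: measurable_funD; exact: measurable_majorant_subl.
- move=> n; apply: measurable_funM => //.
  by apply: measurable_funB; exact: measurable_profile_dist.
- exact: measurable_dkernel.
- by move=> n y; rewrite mulr_ge0// addr_ge0// singular_majorant_ge0.
- by move=> y; rewrite mulr_ge0// addr_ge0// singular_majorant_ge0.
- by move=> n; exact: integral_majorant_sum.
- exact: integral_majorant_sum.
- move=> n y Oy.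
  have [_ r0 rD r1] := dist_boundary (bw_ n) Oy.
  have [_ s0 sD s1] := dist_boundary (bz_ n) Oy.
  rewrite normf_div [X in _ / X]gtr0_norm// ler_pdivrMr//.
  apply: le_trans (profile_lipschitz b_gt0 diam_lt s0 r0 sD rD) _.
  rewrite -/s /m /singular_majorant r1 s1 [X in 2 * X]addrC.
  rewrite ler_wpM2l ?mulr_ge0 ?addr_ge0 ?powR_ge0//.
  apply: le_trans (enorm_dist _ _ _) _.
  by rewrite /z_ opprB addrC subrK enormZ enorm_e mulr1 gtr0_norm.
- by move=> y Oy; exact: dkernel_le.
- by move=> y; exact: majorant_liminf.
- move=> y Oy; have [_ r0 _ r1] := dist_boundary bw Oy.
  apply: cvgMl_tmp; apply: cvgD; apply: cvg_majorant => //;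
    by apply: cvgB => //; exact: cvg_cst.
- move=> y Oy; have [wy _ _ _] := dist_boundary bw Oy.
  apply: cvg_quotient => // n.
    by have [] := dist_boundary (bw_ n) Oy.
  by have [] := dist_boundary (bz_ n) Oy.
- move=> n; under eq_integral do rewrite mulrC EFinM.
  rewrite integralZl//; last exact: integrable_profileB.
  by rewrite integral_profileB// mule0.
Qed.

Lemma integrable_dkernel w : boundary Omega w ->
  lam.-integrable Omega (EFin \o dkernel b w e).
Proof.
move=> bw; pose m v := @singular_majorant R N s v.
pose G y := 2 * (m (w - y) + m (w - y)).
have G0 y : 0 <= G y by rewrite mulr_ge0// addr_ge0// singular_majorant_ge0.
have mG : measurable_fun setT G.
  apply: measurable_funM => //.
  by apply: measurable_funD; exact: measurable_majorant_subl.
have iG : lam.-integrable setT (EFin \o G).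
  apply/integrableP; split; first exact/measurable_EFinP.
  rewrite (eq_integral (fun y => (G y)%:E)); last first.
    by move=> y _ /=; rewrite ger0_norm.
  by rewrite integral_majorant_sum// ltry.
have {}iG : lam.-integrable Omega (EFin \o G).
  by apply: integrableS iG => //; exact: measurableT.
apply: le_integrable iG => //.
  by apply/measurable_EFinP/measurable_funTS; exact: measurable_dkernel.
by move=> y Oy /=; rewrite lee_fin (le_trans (dkernel_le bw Oy))// ler_norm.
Qed.

(** The two cases are those of a critical chord of positive length, with mirror
    images [w] and [z] of each other as its ends, and of a critical point [w] on
    the mirror. *)
Lemma mirror_plane : exists l : R,
  (forall l' x, l <= l' -> Omega x -> l' < dot x e ->
    Omega (reflection e l' x)) /\
  Omega `<=` reflection e l @^-1` Omega.
Proof.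
have [l [w [t [w_ [t_ [lmax wl [t_ge0 bw bz] ch [cw ct]]]]]]] :=
  critical_position oOmega bOmega e1 Omega0.
have cap l' x : l <= l' -> Omega x -> l' < dot x e -> Omega (reflection e l' x).
  by move=> ll'; exact: (cap_reflection oOmega bOmega e1 lmax ll').
exists l; split=> //.
apply: (null_symmetric e1 oOmega).
  by move=> p d nOp d0; exact: C1_boundary_exterior.
have [t0|t_neq0] := eqVneq t 0.
  have le_w : dot w e = l by rewrite -wl t0 mul0r subr0.
  have sw : reflection e l w = w.
    by rewrite /reflection le_w subrr mulr0 scale0r subr0.
  apply: (@antisymmetric_null R N e l e1 Omega oOmega
    (fun x Ox => cap l x (lexx l) Ox) (dkernel b w e)) => //.
  - exact: measurable_dkernel.
  - exact: integrable_dkernel.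
  - move=> y; rewrite /dkernel enormB enorm_reflectionl// sw enormB.
    rewrite dotDl dotNl dot_reflection// dotDl dotNl le_w -mulrN -mulNr.
    by congr (_ * (_ / _)); ring.
  - move=> y Oy yl; have [_ r0 rD _] := dist_boundary bw Oy.
    rewrite /dkernel mulr_gt0 ?divr_gt0//.
      by apply: dprofile_gt0 => //; exact: le_lt_trans diam_lt.
    by rewrite dotDl dotNl le_w subr_gt0.
  - by apply: tangential_integral_le0 ch cw _ => //; rewrite -t0.
have t0 : 0 < t by rewrite lt_def t_neq0.
pose z := w - t *: e.
have sw : reflection e l w = z.
  by rewrite /reflection -wl opprB addrCA subrr addr0 mulrC divfK.
have sz : reflection e l z = w by rewrite -sw reflectionK.
pose K y := profile b (enorm (w - y)) - profile b (enorm (z - y)).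
apply: (@antisymmetric_null R N e l e1 Omega oOmega
    (fun x Ox => cap l x (lexx l) Ox) K) => //.
- by apply: measurable_funB; exact: measurable_profile_dist.
- exact: integrable_profileB.
- move=> y; rewrite /K.
  have -> : enorm (w - reflection e l y) = enorm (z - y).
    by rewrite enormB enorm_reflectionl// sw enormB.
  have -> : enorm (z - reflection e l y) = enorm (w - y).
    by rewrite enormB enorm_reflectionl// sz enormB.
  by rewrite opprB.
- move=> y Oy yl; rewrite /K subr_gt0.
  have [_ r0 rD _] := dist_boundary bw Oy.
  have [_ s0 _ _] := dist_boundary bz Oy.
  apply: (profile_increasing b_gt0 diam_lt) => //.
  rewrite -(@ltr_pXn2r _ 2) ?nnegrE ?enorm_ge0// !sqr_enorm.
  rewrite (_ : z - y = (w - y) - t *: e); last by rewrite /z addrAC.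
  have aE : dot (w - y) e = l + t / 2 - dot y e by rewrite dotDl dotNl -wl; ring.
  move: (w - y) aE => a aE; rewrite !dotE e1 (dotC e a) aE.
  have := mulr_gt0 t0 (_ : 0 < l - dot y e); rewrite subr_gt0 => /(_ yl); lra.
- by rewrite integral_profileB.
Qed.

End mirror.

(** * From mirrors to a ball *)

Section ball_of_mirrors.
Variables (R : realType) (N : nat) (Omega : set 'rV[R]_N).
Hypotheses (N_gt0 : (0 < N)%N) (oOmega : open Omega) (Omega0 : Omega !=set0).
Hypothesis bOmega : bounded_set Omega.
Hypothesis mirrors : forall e : 'rV[R]_N, dot e e = 1 -> exists l : R,
  (forall l' x, l <= l' -> Omega x -> l' < dot x e ->
    Omega (reflection e l' x)) /\
  Omega `<=` reflection e l @^-1` Omega.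

Lemma dot_delta (i : 'I_N) (x : 'rV[R]_N) : dot x (delta_mx ord0 i) = x ord0 i.
Proof.
rewrite /dot (bigD1 i)//= mxE !eqxx mulr1 big1 ?addr0// => j ji.
by rewrite mxE (negbTE ji) andbF mulr0.
Qed.

Lemma dot_delta1 (i : 'I_N) : dot (delta_mx ord0 i) (delta_mx ord0 i) = 1 :> R.
Proof. by rewrite dot_delta mxE !eqxx. Qed.

(** Reflecting the coordinates one after the other, each in its own mirror,
    gives the reflection through the point [c] common to these mirrors. *)
Lemma centrally_symmetric : exists c : 'rV[R]_N,
  forall x, Omega x -> Omega (c + c - x).
Proof.
have /choice[l lP] := fun i => mirrors (dot_delta1 i).
pose c := \row_i l i; exists c.
pose flip k (x : 'rV[R]_N) := \row_(i < N)
  (if (i < k)%N then 2 * l i - x ord0 i else x ord0 i).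
have flipO k x : (k <= N)%N -> Omega x -> Omega (flip k x).
  elim: k => [|k IH] kN Ox.
    by rewrite (_ : flip 0 x = x)//; apply/rowP => i; rewrite mxE.
  have := (lP (Ordinal kN)).2 _ (IH (ltnW kN) Ox).
  rewrite /preimage/= (_ : reflection _ _ _ = flip k.+1 x)//.
  apply/rowP => i; rewrite /reflection dot_delta !mxE eqxx ltnS ltnn /=.
  have [->|ik] := eqVneq i (Ordinal kN).
    by rewrite /= ltnn leqnn; ring.
  by rewrite mulr0 subr0 ltn_neqAle (_ : (i : nat) != k).
move=> x /(flipO _ _ (leqnn N)); congr Omega.
by apply/rowP => i; rewrite !mxE ltn_ord; ring.
Qed.

Variable c : 'rV[R]_N.
Hypothesis cP : forall x, Omega x -> Omega (c + c - x).

Lemma no_translation (a : R) e : dot e e = 1 ->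
  (forall x, Omega x -> Omega (x + a *: e)) -> a = 0.
Proof.
move=> e1 aO; apply: contrapT => /eqP a0; have [x Ox] := Omega0.
have [M MO] := bounded_enorm bOmega.
have xn (n : nat) : Omega (x + (n%:R * a) *: e).
  elim: n => [|n IH]; first by rewrite mul0r scale0r addr0.
  by rewrite -natr1 mulrDl mul1r scalerDl addrA; exact: aO.
have na : 0 < `|a| by rewrite normr_gt0.
pose n := (Num.truncn ((M + enorm x) / `|a|)).+1.
have h : (M + enorm x) / `|a| < n%:R by exact: truncnS_gt.
have e1' : enorm e = 1 by rewrite enormE e1 sqrtr1.
move: h; rewrite ltr_pdivrMr// => h.
have := enormD (x + (n%:R * a) *: e) (- x).
rewrite addrC addKr enormZ e1' mulr1 normrM normr_nat enormN.
have := MO _ (xn n); lra.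
Qed.

(** The mirror and its image through [c] are parallel; composing the two
    reflections gives a translation, which is trivial since [Omega] is
    bounded. *)
Lemma mirror_through_center e l : dot e e = 1 ->
  Omega `<=` reflection e l @^-1` Omega -> l = dot c e.
Proof.
move=> e1 sO.
have : 4 * (l - dot c e) = 0.
  apply: (no_translation e1) => x Ox.
  have := sO _ (cP (sO _ (cP Ox))).
  rewrite /preimage/=; congr Omega; apply/rowP => i.
  by rewrite /reflection !dotE e1 !mxE; ring.
by move=> h; lra.
Qed.

Lemma enorm_normalize (v : 'rV[R]_N) : v != 0 ->
  dot ((enorm v)^-1 *: v) ((enorm v)^-1 *: v) = 1.
Proof.
move=> v0; rewrite !dotE -sqr_enorm mulrA -invfM -expr2 mulVf//.
by rewrite expf_neq0// lt0r_neq0// enorm_gt0.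
Qed.

(** Two points of a sphere centred at [c] are exchanged by the reflection in
    their bisector, which contains [c]. *)
Lemma sphere_invariant x y : enorm (x - c) = enorm (y - c) -> Omega x -> Omega y.
Proof.
move=> xy Ox; have [<-//|nxy] := eqVneq x y.
have d0 : x - y != 0 by rewrite subr_eq0.
have u1 := enorm_normalize d0; have [l [_ sO]] := mirrors u1.
have := sO _ Ox; rewrite (mirror_through_center u1 sO) /preimage/=; congr Omega.
have dn0 : enorm (x - y) != 0 by rewrite lt0r_neq0// enorm_gt0.
have sq : dot (x - c) (x - c) = dot (y - c) (y - c) by rewrite -!sqr_enorm xy.
have h : 2 * (dot x (x - y) - dot c (x - y)) = enorm (x - y) ^+ 2.
  move: sq; rewrite sqr_enorm !dotE (dotC c x) (dotC c y) (dotC y x); lra.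
rewrite /reflection !dotZr -mulrBr mulrCA h scalerA expr2 mulKf// divff//.
by rewrite scale1r opprB addrC subrK.
Qed.

(** The target is the image of [x] in a mirror orthogonal to [x - c] on the far
    side of [c], to which the cap property applies. *)
Lemma shrink x (s : R) : 0 <= s -> s < 1 -> Omega x -> Omega (c + s *: (x - c)).
Proof.
move=> s0 s1 Ox; have [xc|nxc] := eqVneq x c.
  by rewrite xc subrr scaler0 addr0 -xc.
have d0 : x - c != 0 by rewrite subr_eq0.
have rho0 := enorm_gt0 d0.
have u1 := enorm_normalize d0; have [l [cap sO]] := mirrors u1.
set u := _ *: _ in u1 cap sO.
have xu : x = c + enorm (x - c) *: u.
  by rewrite /u scalerA divff ?lt0r_neq0// scale1r addrC subrK.
clearbody u.
have xuE : dot x u = dot c u + enorm (x - c) by rewrite {1}xu !dotE u1 mulr1.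
pose l' := dot c u + (1 + s) / 2 * enorm (x - c).
have ll' : l <= l'.
  rewrite (mirror_through_center u1 sO) lerDl mulr_ge0 ?enorm_ge0//.
  by rewrite divr_ge0// addr_ge0.
have l'x : l' < dot x u by rewrite xuE ltrD2l gtr_pMl//; lra.
have := cap _ _ ll' Ox l'x; congr Omega.
rewrite /reflection xuE /l'; apply/rowP => i.
have : x ord0 i = (c + enorm (x - c) *: u) ord0 i by rewrite -xu.
by rewrite !mxE => ->; field.
Qed.

Lemma ball_of_mirrors : exists r : R, 0 < r /\ Omega = eball c r.
Proof.
have inner x y : Omega x -> enorm (y - c) < enorm (x - c) -> Omega y.
  move=> Ox yx; have r0 : 0 < enorm (x - c) by apply: le_lt_trans yx; exact: enorm_ge0.
  have O' := @shrink x (enorm (y - c) / enorm (x - c)) _ _ Ox.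
  apply: (sphere_invariant _ (O' _ _)).
  - rewrite addrC addKr enormZ ger0_norm ?divr_ge0 ?enorm_ge0//.
    by rewrite divfK// lt0r_neq0.
  - by rewrite divr_ge0 ?enorm_ge0.
  - by rewrite ltr_pdivrMr// mul1r.
have outer x : Omega x -> exists2 y, Omega y & enorm (x - c) < enorm (y - c).
  move=> Ox; have [d d0 dO] := open_enorm oOmega Ox.
  have [u [u1 uxc]] : exists u : 'rV[R]_N,
      dot u u = 1 /\ x - c = enorm (x - c) *: u.
    have [xc|xc] := eqVneq (x - c) 0.
      exists (delta_mx ord0 (Ordinal N_gt0)); rewrite dot_delta1; split=> //.
      by rewrite xc enorm0 scale0r.
    exists ((enorm (x - c))^-1 *: (x - c)); rewrite enorm_normalize//; split=> //.
    by rewrite scalerA divff ?scale1r// lt0r_neq0// enorm_gt0.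
  have eu : enorm u = 1 by rewrite enormE u1 sqrtr1.
  exists (x + (d / 2) *: u).
    apply: dO; rewrite addrC addKr enormZ eu mulr1 gtr0_norm ?divr_gt0//; lra.
  rewrite addrAC {2}uxc -scalerDl enormZ eu mulr1 ger0_norm.
    by rewrite ltrDl divr_gt0.
  by rewrite addr_ge0 ?enorm_ge0// divr_ge0// ltW.
pose E := [set enorm (x - c) | x in Omega].
have Esup : has_sup E.
  have [M MO] := bounded_enorm bOmega; have [x Ox] := Omega0.
  split; first by exists (enorm (x - c)), x.
  exists (M + enorm c) => _ [z Oz <-].
  by rewrite (le_trans (enormD _ _))// enormN lerD2r MO.
have lt_sup x : Omega x -> enorm (x - c) < sup E.
  move=> /outer[y Oy xy]; apply: lt_le_trans xy _.
  by apply: sup_ubound; [case: Esup|exists y].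
exists (sup E); split.
  by have [x /lt_sup] := Omega0; apply: le_lt_trans; exact: enorm_ge0.
apply/seteqP; split=> x; first exact: lt_sup.
rewrite /eball/= => xr.
have dr : 0 < sup E - enorm (x - c) by rewrite subr_gt0.
have [_ [y Oy <-]] := sup_adherent dr Esup.
by rewrite subKr; exact: inner.
Qed.

End ball_of_mirrors.

Theorem theorem2 (R : realType) (N : nat) (alpha : R) (Omega : set 'rV[R]_N)
  (N_gt0 : (0 < N)%N)
  (alpha_gtN : N%:R < alpha)
  (domain_Omega : domain Omega)
  (bounded_Omega : bounded_set Omega)
  (C1_Omega : C1_boundary Omega)
  (diam_Omega : diam Omega < expR (1 / (N%:R - alpha)))
  (u_constant : exists c : R, forall x : 'rV[R]_N,
     boundary Omega x -> log_riesz_potential alpha Omega x = c) :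
  exists (c : 'rV[R]_N) (r : R), 0 < r /\ Omega = eball c r.
Proof.
have [ne op _] := domain_Omega.
have mirrors := mirror_plane N_gt0 alpha_gtN op ne bounded_Omega C1_Omega
  diam_Omega u_constant.
have [c cP] := centrally_symmetric mirrors.
by exists c; exact: (ball_of_mirrors N_gt0 op ne bounded_Omega mirrors cP).
Qed.
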